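(* Let $\mathcal C$ be a parsummable category. (i) The parsummable category $\mathcal C^{\mathrm{sat}}$ is saturated. (ii) The functor $s:\mathcal C\to\mathcal C^{\mathrm{sat}}$ is a morphism of parsummable categories and an equivalence of underlying categories. (iii) If $\mathcal C$ is saturated, then $s:\mathcal C\to\mathcal C^{\mathrm{sat}}$ is a global equivalence of parsummable categories.
   Context: Let $\omega=\{0,1,2,\dots\}$ and let $M$ be the monoid, under composition, of injective maps $\omega\to\omega$. For a set $X$, $EX$ denotes the category with object set $X$ and exactly one morphism, written $(y,x):x\to y$, between any two objects. Then $\mathcal M=EM$ is a strict monoidal category. An $\mathcal M$-category is a small category $\mathcal C$ with a strict (strictly associative and unital) action functor $\mathcal M\times\mathcal C\to\mathcal C$; morphisms are functors commuting strictly with the actions. For $u,v\in M$ write $u_*:\mathcal C\to\mathcal C$ for the action of $u$ and $[v,u]^x:u_*(x)\to v_*(x)$ for the isomorphism given by acting with $(v,u)$ on $1_x$. An object $x$ is supported on $A\subseteq\omega$ if $u_*(x)=x$ for every $u\in M$ that is the identity on $A$; it is finitely supported if it is supported on some finite set. $\mathcal C$ is tame if all its objects are finitely supported; in general $\mathcal C^\tau$ denotes the full ($\mathcal M$-stable) subcategory of finitely supported objects. Fix for every countably infinite set $U$ a bijection $\kappa_U:\omega\to U$, with $\kappa_\omega=\mathrm{id}$. For an $\mathcal M$-category $\mathcal C$ put $\mathcal C[U]=\mathcal C$, and let an injection $j:U\to V$ induce $j_*:=(\kappa_V^{-1}j\kappa_U)_*:\mathcal C[U]\to\mathcal C[V]$.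 If a group $G$ acts on $U$, this makes $\mathcal C[U]$ a category with strict $G$-action. For a finite group $G$, $\omega^G$ is the $G$-set of maps $G\to\omega$ with $(g\cdot f)(h)=f(g^{-1}h)$. $F^G\mathcal C=\mathcal C[\omega^G]^G$ is the category of $G$-fixed objects and morphisms, and $F^{hG}\mathcal C=\mathrm{cat}^G(EG,\mathcal C[\omega^G])$ is the category of $G$-equivariant functors and $G$-equivariant natural transformations ($G$ acting on $EG$ by left translation). $\kappa:F^G\mathcal C\to F^{hG}\mathcal C$ sends $x$ to the constant functor at $x$. $\mathcal C$ is saturated if $\kappa$ is an equivalence of categories for every finite group $G$. A morphism $\Phi$ of $\mathcal M$-categories is a global equivalence if for every finite group $G$ the functor $F^G\Phi$ is a weak equivalence of categories (i.e. induces a weak equivalence on nerves). A parsummable category is saturated, and a morphism of parsummable categories is a global equivalence, if this holds for the underlying $\mathcal M$-categories. The box product $\mathcal C\boxtimes\mathcal D$ of $\mathcal M$-categories is the full subcategory of $\mathcal C\times\mathcal D$ (diagonal $\mathcal M$-action) on the pairs $(c,d)$ such that $c$ is supported on $A$ and $d$ on $B$ for some disjoint $A,B\subseteq\omega$; it is a symmetric monoidal product on tame $\mathcal M$-categories with unit the terminal category. A parsummable category is a commutative monoid for $\boxtimes$ in tame $\mathcal M$-categories: a tame $\mathcal M$-category $\mathcal C$ with an $\mathcal M$-equivariant functor $+:\mathcal C\boxtimes\mathcal C\to\mathcal C$ that is strictly associative, commutative and unital, with unit an object $0$ fixed by $\mathcal M$. Morphisms are $\mathcal M$-equivariant functors strictly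 preserving $0$ and $+$. Saturation: for an $\mathcal M$-category $\mathcal C$, $\mathrm{cat}(\mathcal M,\mathcal C)$ is the category of functors $\mathcal M\to\mathcal C$ and natural transformations, with the following $\mathcal M$-action: $u_*(X)(w)=u_*(X(wu))$, $u_*(X)(w,v)=u_*(X(wu,vu))$, $u_*(\Psi)(w)=u_*(\Psi(wu))$, and $[u',u]^X(w)=u'_*(X(wu',wu))\circ[u',u]^{X(wu)}$. For tame $\mathcal C$ put $\mathcal C^{\mathrm{sat}}=\mathrm{cat}(\mathcal M,\mathcal C)^\tau$. If $\mathcal C$ is parsummable, $\mathcal C^{\mathrm{sat}}$ is parsummable with objectwise structure: zero object the constant functor at $0$, and for disjointly supported $X,Y$ in $\mathcal C^{\mathrm{sat}}$, $(X+Y)(u)=X(u)+Y(u)$, $(X+Y)(v,u)=X(v,u)+Y(v,u)$ (similarly on morphisms). The functor $s$ sends an object $x$ to the constant functor $s(x)(w)=x$, $s(x)(w,v)=1_x$, and a morphism $f$ to the constant transformation $s(f)(w)=f$.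
   Formalization: In the box product, the disjoint sets A and B supporting c and d are required to be finite; with arbitrary A, B every object is supported on the complement of any point, and the box product is not associative on tame M-categories. *)

(* Defs.v *)
From mathcomp Require Import all_boot all_fingroup.
From mathcomp Require Import boolp classical_sets functions cardinality.

Set Implicit Arguments.
Unset Strict Implicit.
Unset Printing Implicit Defensive.

Local Open Scope classical_set_scope.
Local Open Scope card_scope.

#[local] Obligation Tactic := idtac.

(* All morphisms of a category live in one type and composition is only defined
   on composable pairs. The strict identities below (actions, sums, equality of
   functors) then are plain equations, without transport along equalities
   between objects. The composability proofs are irrelevant. *)
Record is_category (Ob Mor : Type) (src tgt : Mor -> Ob) (idm : Ob -> Mor)
  (compm : forall g f : Mor, src g = tgt f -> Mor) : Prop := IsCategory {
  is_category_src_idm : forall x, src (idm x) = x;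
  is_category_tgt_idm : forall x, tgt (idm x) = x;
  is_category_src_compm :
    forall g f (e : src g = tgt f), src (compm g f e) = src f;
  is_category_tgt_compm :
    forall g f (e : src g = tgt f), tgt (compm g f e) = tgt g;
  is_category_1l :
    forall x f (e : src (idm x) = tgt f), compm (idm x) f e = f;
  is_category_1r :
    forall x g (e : src g = tgt (idm x)), compm g (idm x) e = g;
  is_category_A : forall h g f (hg : src h = tgt g) (gf : src g = tgt f)
    (hg_f : src (compm h g hg) = tgt f) (h_gf : src h = tgt (compm g f gf)),
    compm (compm h g hg) f hg_f = compm h (compm g f gf) h_gf
}.

Record category := Category {
  Ob : Type;
  Mor : Type;
  src : Mor -> Ob;
  tgt : Mor -> Ob;
  idm : Ob -> Mor;
  compm : forall g f : Mor, src g = tgt f -> Mor;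
  categoryP : is_category idm compm
}.
Arguments src {c} _.
Arguments tgt {c} _.
Arguments idm {c} _.
Arguments compm {c} g f e.

Section CategoryTheory.
Variable C : category.
Implicit Types (x : Ob C) (f g h : Mor C).

Lemma src_idm x : src (idm x) = x.
Proof. exact: is_category_src_idm (categoryP C) x. Qed.

Lemma tgt_idm x : tgt (idm x) = x.
Proof. exact: is_category_tgt_idm (categoryP C) x. Qed.

Lemma src_compm g f (e : src g = tgt f) : src (compm g f e) = src f.
Proof. exact: is_category_src_compm (categoryP C) g f e. Qed.

Lemma tgt_compm g f (e : src g = tgt f) : tgt (compm g f e) = tgt g.
Proof. exact: is_category_tgt_compm (categoryP C) g f e. Qed.

Lemma compm1l x f (e : src (idm x) = tgt f) : compm (idm x) f e = f.
Proof. exact: is_category_1l (categoryP C) x f e. Qed.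

Lemma compm1r x g (e : src g = tgt (idm x)) : compm g (idm x) e = g.
Proof. exact: is_category_1r (categoryP C) x g e. Qed.

Lemma compmA h g f (hg : src h = tgt g) (gf : src g = tgt f)
  (hg_f : src (compm h g hg) = tgt f) (h_gf : src h = tgt (compm g f gf)) :
  compm (compm h g hg) f hg_f = compm h (compm g f gf) h_gf.
Proof. exact: is_category_A (categoryP C) h g f hg gf hg_f h_gf. Qed.

End CategoryTheory.
Arguments compmA {C h g f} hg gf hg_f h_gf.

Lemma compm_eq (C : category) (g g' f f' : Mor C) (e : src g = tgt f)
  (e' : src g' = tgt f') : g = g' -> f = f' -> compm g f e = compm g' f' e'.
Proof.
by move=> eg ef; subst g' f'; rewrite (Prop_irrelevance e e').
Qed.

Lemma compm_idl (C : category) (g f f' : Mor C) (e : src g = tgt f)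
  (x : Ob C) : g = idm x -> f = f' -> compm g f e = f'.
Proof. by move=> eg ef; subst g f'; exact: compm1l. Qed.

Lemma eq_fst (A B : Type) (x y : A * B) : x = y -> x.1 = y.1.
Proof. by move=> ->. Qed.

Lemma eq_snd (A B : Type) (x y : A * B) : x = y -> x.2 = y.2.
Proof. by move=> ->. Qed.

Lemma eq_sval (T : Type) (P : T -> Prop) (x y : {x | P x}) :
  x = y -> sval x = sval y.
Proof. by move=> ->. Qed.

Record is_functor (C D : category) (O : Ob C -> Ob D) (M : Mor C -> Mor D) :
  Prop := IsFunctor {
  is_functor_src : forall f, src (M f) = O (src f);
  is_functor_tgt : forall f, tgt (M f) = O (tgt f);
  is_functor_idm : forall x, M (idm x) = idm (O x);
  is_functor_compm : forall g f (e : src g = tgt f)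
    (e' : src (M g) = tgt (M f)), M (compm g f e) = compm (M g) (M f) e'
}.

Record functor (C D : category) := Functor {
  fO :> Ob C -> Ob D;
  fM : Mor C -> Mor D;
  functorP : is_functor fO fM
}.

Section FunctorTheory.
Variables (C D : category) (F : functor C D).

Lemma src_fM f : src (fM F f) = F (src f).
Proof. exact: is_functor_src (functorP F) f. Qed.

Lemma tgt_fM f : tgt (fM F f) = F (tgt f).
Proof. exact: is_functor_tgt (functorP F) f. Qed.

Lemma fM_idm x : fM F (idm x) = idm (F x).
Proof. exact: is_functor_idm (functorP F) x. Qed.

Lemma fM_compm g f (e : src g = tgt f) (e' : src (fM F g) = tgt (fM F f)) :
  fM F (compm g f e) = compm (fM F g) (fM F f) e'.
Proof. exact: is_functor_compm (functorP F) g f e e'. Qed.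

End FunctorTheory.

Lemma functor_eq (C D : category) (F G : functor C D) :
  (forall x, F x = G x) -> (forall f, fM F f = fM G f) -> F = G.
Proof.
case: F => o m p; case: G => o' m' p' /= /funext eo /funext em.
subst o' m'; congr Functor; exact: Prop_irrelevance.
Qed.

Program Definition idF (C : category) : functor C C :=
  @Functor C C id id _.
Next Obligation.
move=> C; split => // g f e e'.
exact: compm_eq.
Qed.

Program Definition compF (C D E : category)
  (G : functor D E) (F : functor C D) :
  functor C E :=
  @Functor C E (fun x => G (F x)) (fun f => fM G (fM F f)) _.
Next Obligation.
move=> C D E G F; split.
- by move=> f; rewrite !src_fM.
- by move=> f; rewrite !tgt_fM.
- by move=> x; rewrite !fM_idm.
- move=> g f e e'.
  have e1 : src (fM F g) = tgt (fM F f) by rewrite src_fM tgt_fM e.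
  by rewrite (fM_compm e e1) (fM_compm e1 e').
Qed.

Record is_natural (C D : category) (F G : functor C D) (T : Ob C -> Mor D) :
  Prop := IsNatural {
  is_natural_src : forall x, src (T x) = F x;
  is_natural_tgt : forall x, tgt (T x) = G x;
  is_natural_nat : forall f (e : src (T (tgt f)) = tgt (fM F f))
    (e' : src (fM G f) = tgt (T (src f))),
    compm (T (tgt f)) (fM F f) e = compm (fM G f) (T (src f)) e'
}.

Record nattrans (C D : category) := NatTrans {
  ntsrc : functor C D;
  nttgt : functor C D;
  ntc :> Ob C -> Mor D;
  nattransP : is_natural ntsrc nttgt ntc
}.

Section NattransTheory.
Variables (C D : category) (T : nattrans C D).

Lemma src_ntc x : src (T x) = ntsrc T x.
Proof. exact: is_natural_src (nattransP T) x. Qed.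

Lemma tgt_ntc x : tgt (T x) = nttgt T x.
Proof. exact: is_natural_tgt (nattransP T) x. Qed.

Lemma ntc_nat f (e : src (T (tgt f)) = tgt (fM (ntsrc T) f))
  (e' : src (fM (nttgt T) f) = tgt (T (src f))) :
  compm (T (tgt f)) (fM (ntsrc T) f) e = compm (fM (nttgt T) f) (T (src f)) e'.
Proof. exact: is_natural_nat (nattransP T) f e e'. Qed.

End NattransTheory.

Lemma nattrans_eq (C D : category) (S T : nattrans C D) :
  ntsrc S = ntsrc T -> nttgt S = nttgt T -> (forall x, S x = T x) -> S = T.
Proof.
case: S => s t m p; case: T => s' t' m' p' /= es et /funext em.
subst s' t' m'; congr NatTrans; exact: Prop_irrelevance.
Qed.

Definition is_iso (C : category) (f : Mor C) : Prop :=
  exists (g : Mor C) (gf : src g = tgt f) (fg : src f = tgt g),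
    compm g f gf = idm (src f) /\ compm f g fg = idm (tgt f).

Definition nat_iso (C D : category) (F G : functor C D) : Prop :=
  exists S : nattrans C D,
    [/\ ntsrc S = F, nttgt S = G & forall x, is_iso (S x)].

Definition is_equivalence (C D : category) (F : functor C D) : Prop :=
  exists G : functor D C,
    nat_iso (compF G F) (idF C) /\ nat_iso (compF F G) (idF D).

(* The morphism (y, x) goes from x to y. *)
Program Definition indisc (X : Type) : category :=
  @Category X (X * X) snd fst (fun x => (x, x))
  (fun g f _ => (g.1, f.2)) _.
Next Obligation.
move=> X; split => //=.
- by move=> x [y z] /= ->.
- by move=> x [y z] /= ->.
Qed.

Program Definition prodC (C D : category) : category :=
  @Category (Ob C * Ob D) (Mor C * Mor D)
  (fun f => (src f.1, src f.2)) (fun f => (tgt f.1, tgt f.2))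
  (fun x => (idm x.1, idm x.2))
  (fun g f e => (compm g.1 f.1 (eq_fst e), compm g.2 f.2 (eq_snd e))) _.
Next Obligation.
move=> C D; split.
- by move=> [x y] /=; rewrite !src_idm.
- by move=> [x y] /=; rewrite !tgt_idm.
- by move=> g f e /=; rewrite !src_compm.
- by move=> g f e /=; rewrite !tgt_compm.
- by move=> [x y] [f f'] e /=; rewrite !compm1l.
- by move=> [x y] [f f'] e /=; rewrite !compm1r.
- move=> h g f hg gf e e' /=.
  rewrite (@compmA C _ _ _ _ (eq_fst gf) _ (eq_fst e')).
  by rewrite (@compmA D _ _ _ _ (eq_snd gf) _ (eq_snd e')).
Qed.

Section FunctorCategory.
Variables A C : category.

Lemma nt_comp_ok (T S : nattrans A C) (e : ntsrc T = nttgt S) x :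
  src (T x) = tgt (S x).
Proof. by rewrite src_ntc tgt_ntc e. Qed.

Program Definition idnt (F : functor A C) : nattrans A C :=
  @NatTrans A C F F (fun x => idm (F x)) _.
Next Obligation.
move=> F; split.
- by move=> x; rewrite src_idm.
- by move=> x; rewrite tgt_idm.
- by move=> f e e'; rewrite compm1l compm1r.
Qed.

Program Definition compnt (T S : nattrans A C) (e : ntsrc T = nttgt S) :
  nattrans A C :=
  @NatTrans A C (ntsrc S) (nttgt T)
  (fun x => compm (T x) (S x) (nt_comp_ok e x)) _.
Next Obligation.
move=> T S e; split.
- by move=> x; rewrite src_compm src_ntc.
- by move=> x; rewrite tgt_compm tgt_ntc.
- move=> f e1 e2.
  have a1 : src (S (tgt f)) = tgt (fM (ntsrc S) f) by rewrite src_ntc tgt_fM.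
  have a2 : src (T (tgt f)) = tgt (compm _ _ a1).
    by rewrite tgt_compm; exact: nt_comp_ok.
  rewrite (compmA _ a1 _ a2).
  have a3 : src (fM (nttgt S) f) = tgt (S (src f)) by rewrite src_fM tgt_ntc.
  have a4 : src (T (tgt f)) = tgt (compm _ _ a3).
    by rewrite tgt_compm src_ntc tgt_fM e.
  rewrite (compm_eq a2 a4 erefl (ntc_nat a1 a3)).
  have a5 : src (T (tgt f)) = tgt (fM (ntsrc T) f) by rewrite src_ntc tgt_fM.
  have a6 : src (T (tgt f)) = tgt (fM (nttgt S) f) by rewrite -e.
  have a7 : src (compm _ _ a6) = tgt (S (src f)) by rewrite src_compm a3.
  rewrite -(compmA a6 a3 a7 a4).
  have a8 : src (fM (nttgt T) f) = tgt (T (src f)) by rewrite src_fM tgt_ntc.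
  have a9 : src (compm _ _ a8) = tgt (S (src f)).
    by rewrite src_compm; exact: nt_comp_ok.
  rewrite (@compm_eq C _ (compm _ _ a8) _ _ a7 a9) //; first exact: compmA.
  rewrite -(ntc_nat a5 a8).
  by apply: compm_eq => //; rewrite e.
Qed.

Program Definition funcat : category :=
  @Category (functor A C) (nattrans A C)
  (@ntsrc A C) (@nttgt A C) idnt compnt _.
Next Obligation.
split => //=.
- move=> F T e; apply: nattrans_eq => //= x; exact: compm1l.
- move=> F T e; apply: nattrans_eq => //= x; exact: compm1r.
- move=> h g f hg gf e1 e2; apply: nattrans_eq => //= x; exact: compmA.
Qed.

Program Definition constF (x : Ob C) : functor A C :=
  @Functor A C (fun _ => x) (fun _ => idm x) _.
Next Obligation.
move=> x; split => //=.
- by move=> _; rewrite src_idm.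
- by move=> _; rewrite tgt_idm.
- by move=> g f e e'; rewrite compm1l.
Qed.

Program Definition constnt (f : Mor C) : nattrans A C :=
  @NatTrans A C (constF (src f)) (constF (tgt f)) (fun _ => f) _.
Next Obligation.
move=> f; split => //=.
by move=> g e e'; rewrite compm1l compm1r.
Qed.

Program Definition constants : functor C funcat :=
  @Functor C funcat constF constnt _.
Next Obligation.
split => //=.
- move=> x; apply: nattrans_eq => //=.
  + by rewrite src_idm.
  + by rewrite tgt_idm.
- move=> g f e e'; apply: nattrans_eq => //=.
  + by rewrite src_compm.
  + by rewrite tgt_compm.
  + by move=> x; exact: compm_eq.
Qed.

End FunctorCategory.

Record is_subcategory (C : category) (O : Ob C -> Prop) (M : Mor C -> Prop) :
  Prop := IsSubcategory {
  is_subcategory_src : forall f, M f -> O (src f);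
  is_subcategory_tgt : forall f, M f -> O (tgt f);
  is_subcategory_idm : forall x, O x -> M (idm x);
  is_subcategory_compm :
    forall g f (e : src g = tgt f), M g -> M f -> M (compm g f e)
}.

Record subcategory (C : category) := Subcategory {
  sO : Ob C -> Prop;
  sM : Mor C -> Prop;
  subcategoryP : is_subcategory sO sM
}.

Section SubcategoryTheory.
Variables (C : category) (S : subcategory C).

Lemma sM_src f : sM S f -> sO S (src f).
Proof. exact: is_subcategory_src (subcategoryP S) f. Qed.

Lemma sM_tgt f : sM S f -> sO S (tgt f).
Proof. exact: is_subcategory_tgt (subcategoryP S) f. Qed.

Lemma sM_idm x : sO S x -> sM S (idm x).
Proof. exact: is_subcategory_idm (subcategoryP S) x. Qed.

Lemma sM_compm g f (e : src g = tgt f) :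
  sM S g -> sM S f -> sM S (compm g f e).
Proof. exact: is_subcategory_compm (subcategoryP S) g f e. Qed.

End SubcategoryTheory.

Lemma sig_eq (T : Type) (P : T -> Prop) (x y : {x | P x}) :
  proj1_sig x = proj1_sig y -> x = y.
Proof. by case: x y => [x p] [y q] /= e; apply: eq_exist. Qed.

Program Definition subcat (C : category) (S : subcategory C) : category :=
  @Category {x | sO S x} {f | sM S f}
  (fun f => exist _ (src (sval f)) (sM_src (svalP f)))
  (fun f => exist _ (tgt (sval f)) (sM_tgt (svalP f)))
  (fun x => exist _ (idm (sval x)) (sM_idm (svalP x)))
  (fun g f e => exist _ (compm (sval g) (sval f) (eq_sval e))
                  (sM_compm _ (svalP g) (svalP f))) _.
Next Obligation.
move=> C S; split.
- by move=> x; apply: sig_eq; rewrite /= src_idm.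
- by move=> x; apply: sig_eq; rewrite /= tgt_idm.
- by move=> g f e; apply: sig_eq; rewrite /= src_compm.
- by move=> g f e; apply: sig_eq; rewrite /= tgt_compm.
- by move=> x f e; apply: sig_eq; rewrite /= compm1l.
- by move=> x f e; apply: sig_eq; rewrite /= compm1r.
- by move=> h g f hg gf e1 e2; apply: sig_eq; exact: compmA.
Qed.

Program Definition full (C : category) (P : Ob C -> Prop) : subcategory C :=
  @Subcategory C P (fun f => P (src f) /\ P (tgt f)) _.
Next Obligation.
move=> C P; split.
- by move=> f [].
- by move=> f [].
- by move=> x Px; rewrite src_idm tgt_idm.
- by move=> g f e [_ Pg] [Pf _]; rewrite src_compm tgt_compm.
Qed.

Program Definition incl (C : category) (S : subcategory C) :
  functor (subcat S) C :=
  @Functor (subcat S) C sval sval _.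
Next Obligation.
move=> C S; split => // g f e e'.
exact: compm_eq.
Qed.

Program Definition corestr (C D : category)
  (F : functor C D) (S : subcategory D)
  (FO : forall x, sO S (F x)) (FM : forall f, sM S (fM F f)) :
  functor C (subcat S) :=
  @Functor C (subcat S) (fun x => exist _ (F x) (FO x))
  (fun f => exist _ (fM F f) (FM f)) _.
Next Obligation.
move=> C D F S FO FM; split.
- by move=> f; apply: sig_eq; rewrite /= src_fM.
- by move=> f; apply: sig_eq; rewrite /= tgt_fM.
- by move=> f; apply: sig_eq; rewrite /= fM_idm.
- by move=> g f e e'; apply: sig_eq; exact: fM_compm.
Qed.

Record monotone (m n : nat) := Monotone {
  mfun :> 'I_m.+1 -> 'I_n.+1;
  mfun_homo : forall i j : 'I_m.+1, i <= j -> mfun i <= mfun j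
}.

Lemma monotone_eq m n (a b : monotone m n) : (forall i, a i = b i) -> a = b.
Proof.
case: a b => [a p] [b q] /= /funext e; subst b.
by rewrite (Prop_irrelevance p q).
Qed.

Definition mono1 n : monotone n n := Monotone (mfun := id) (fun _ _ h => h).

Definition monoM l m n (b : monotone m n) (a : monotone l m) : monotone l n :=
  Monotone (mfun := fun i => b (a i))
    (fun i j h => mfun_homo b (mfun_homo a h)).

Record sset := SSet {
  simp :> nat -> Type;
  smap : forall m n, monotone m n -> simp n -> simp m;
  smap1 : forall n (x : simp n), smap (mono1 n) x = x;
  smapM : forall l m n (b : monotone m n) (a : monotone l m) (x : simp n),
    smap (monoM b a) x = smap a (smap b x)
}.
Arguments smap {s m n} _ _.

Record ssmap (X Y : sset) := SSMap {
  ssm :> forall n, X n -> Y n;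
  ssm_nat : forall m n (a : monotone m n) (x : X n),
    ssm (smap a x) = smap a (ssm x)
}.

Definition compS (X Y Z : sset) (g : ssmap Y Z) (f : ssmap X Y) : ssmap X Z.
Proof.
apply: (@SSMap X Z (fun n x => g n (f n x))).
by move=> m n a x; rewrite !ssm_nat.
Defined.

Definition simplex (n : nat) : sset.
Proof.
apply: (@SSet (fun m => monotone m n) (fun l m a b => monoM b a)).
- by move=> m x; apply: monotone_eq.
- by move=> l m k b a x; apply: monotone_eq.
Defined.

(* The simplices of the k-th horn: the image together with k is not all of
   [n]. *)
Definition in_horn n (k : 'I_n.+1) m (a : monotone m n) : Prop :=
  exists j, j <> k /\ forall i, a i <> j.

Lemma in_hornM n (k : 'I_n.+1) l m (b : monotone m n) (a : monotone l m) :
  in_horn k b -> in_horn k (monoM b a).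
Proof. by move=> [j [jk bj]]; exists j; split=> // i; exact: bj. Qed.

Definition horn n (k : 'I_n.+1) : sset.
Proof.
apply: (@SSet (fun m => {b : monotone m n | in_horn k b})
  (fun l m a x => exist _ (monoM (sval x) a) (in_hornM a (svalP x)))).
- by move=> m x; apply: sig_eq; apply: monotone_eq.
- by move=> l m r b a x; apply: sig_eq; apply: monotone_eq.
Defined.

Definition horn_incl n (k : 'I_n.+1) : ssmap (horn k) (simplex n) :=
  @SSMap (horn k) (simplex n)
    (fun m (x : {b : monotone m n | in_horn k b}) => sval x)
    (fun _ _ _ _ => erefl).

Definition kan (K : sset) : Prop :=
  forall n (k : 'I_n.+2) (h : ssmap (horn k) K),
    exists e : ssmap (simplex n.+1) K,
      forall m (x : horn k m), e m (horn_incl k m x) = h m x.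

Definition prodS (X Y : sset) : sset.
Proof.
apply: (@SSet (fun n => (X n * Y n)%type)
  (fun m n a x => (smap a x.1, smap a x.2))).
- by move=> n [x y]; rewrite /= !smap1.
- by move=> l m n b a [x y]; rewrite /= !smapM.
Defined.

Definition const_mono m n (i : 'I_n.+1) : monotone m n :=
  Monotone (mfun := fun _ => i) (fun _ _ _ => leqnn _).

(* An edge of the simplicial mapping space Map(X, K). *)
Definition edge_homotopy (X K : sset) (f g : ssmap X K) : Prop :=
  exists h : ssmap (prodS X (simplex 1)) K, forall n (x : X n),
    h n (x, const_mono n ord0) = f n x /\
    h n (x, const_mono n ord_max) = g n x.

(* f and g are in the same path component of Map(X, K). *)
Inductive homotopic (X K : sset) : ssmap X K -> ssmap X K -> Prop :=
| homotopic_refl f : homotopic f f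
| homotopic_edge f g h :
    edge_homotopy f g -> homotopic g h -> homotopic f h
| homotopic_edge_inv f g h :
    edge_homotopy g f -> homotopic g h -> homotopic f h.

(* A map X -> Y is a weak homotopy equivalence if, for every Kan complex K,
   restriction along it is a bijection pi_0 Map(Y, K) -> pi_0 Map(X, K). *)
Definition weak_homotopy_equivalence (X Y : sset) (f : ssmap X Y) : Prop :=
  forall K : sset, kan K ->
    (forall g : ssmap X K, exists h : ssmap Y K, homotopic (compS h f) g) /\
    (forall h h' : ssmap Y K,
       homotopic (compS h f) (compS h' f) -> homotopic h h').

(* The poset [n] as a category; the pair (j, i) with i <= j is the morphism from
   i to j. *)
Program Definition ordsub (n : nat) : subcategory (indisc 'I_n.+1) :=
  @Subcategory (indisc 'I_n.+1) (fun _ => True) (fun f => f.2 <= f.1) _.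
Next Obligation.
move=> n; split.
- by [].
- by [].
- by move=> x _ /=.
- by move=> [k j] [j' i] /= -> h1 h2; exact: leq_trans h2 h1.
Qed.

Definition ordcat (n : nat) : category := subcat (ordsub n).

Program Definition ordF m n (a : monotone m n) :
  functor (ordcat m) (ordcat n) :=
  @Functor (ordcat m) (ordcat n) (fun x => exist _ (a (sval x)) I)
  (fun f => exist _ (a (sval f).1, a (sval f).2) (mfun_homo a (svalP f))) _.
Next Obligation.
move=> a; split.
all: by move=> *; exact: sig_eq.
Qed.

Definition nerve (C : category) : sset.
Proof.
apply: (@SSet (fun n => functor (ordcat n) C)
  (fun m n a x => compF x (ordF a))).
- move=> n x; apply: functor_eq => [[i []]|f] //=.
  by congr (fM x _); apply: sig_eq; case: f => [[]].
- move=> l m n b a x; apply: functor_eq => //= f.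
  by congr (fM x _); apply: sig_eq.
Defined.

Definition nerve_map (C D : category) (F : functor C D) :
  ssmap (nerve C) (nerve D).
Proof.
apply: (@SSMap (nerve C) (nerve D) (fun n x => compF F x)).
by move=> m n a x; apply: functor_eq.
Defined.

Definition weak_equivalence (C D : category) (F : functor C D) : Prop :=
  weak_homotopy_equivalence (nerve_map F).

Record inj := Inj {
  inj_fun :> nat -> nat;
  inj_injective : injective inj_fun
}.

Lemma inj_eq_ext (u v : inj) : (forall n, u n = v n) -> u = v.
Proof.
case: u v => [u p] [v q] /= /funext e; subst v.
by rewrite (Prop_irrelevance p q).
Qed.

Definition inj1 : inj := Inj (@inj_id nat).
Definition injM (u v : inj) : inj :=
  Inj (inj_comp (@inj_injective u) (@inj_injective v)).

Lemma inj1M u : injM inj1 u = u. Proof. exact: inj_eq_ext. Qed.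
Lemma injM1 u : injM u inj1 = u. Proof. exact: inj_eq_ext. Qed.
Lemma injMA u v w : injM u (injM v w) = injM (injM u v) w.
Proof. exact: inj_eq_ext. Qed.

Definition EM : category := indisc inj.

Record is_action (C : category) (A : functor (prodC EM C) C) : Prop :=
  IsAction {
  is_action1O : forall x, A (inj1, x) = x;
  is_action1M : forall f, fM A ((inj1, inj1), f) = f;
  is_actionMO : forall u v x, A (u, A (v, x)) = A (injM u v, x);
  is_actionMM : forall v u v' u' f,
    fM A ((v, u), fM A ((v', u'), f)) = fM A ((injM v v', injM u u'), f)
}.

Record Mcat := MCat {
  mc :> category;
  act : functor (prodC EM mc) mc;
  actP : is_action act
}.
Arguments act {m}.

(* The functor u_* on objects and on morphisms, and the isomorphism
   [v,u]^x : u_* x -> v_* x. *)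
Definition uO (C : Mcat) (u : inj) (x : Ob C) : Ob C := act (u, x).
Definition uM (C : Mcat) (u : inj) (f : Mor C) : Mor C := fM act ((u, u), f).
Definition bracket (C : Mcat) (v u : inj) (x : Ob C) : Mor C :=
  fM act ((v, u), idm x).

Record equivariant (C D : Mcat) (F : functor C D) : Prop := Equivariant {
  eqvO : forall u x, F (act (u, x)) = act (u, F x);
  eqvM : forall v u f, fM F (fM act ((v, u), f)) = fM act ((v, u), fM F f)
}.

Section ActLemmas.
Variable C : Mcat.

Lemma act1O (x : Ob C) : act (inj1, x) = x.
Proof. exact: is_action1O (actP C) x. Qed.

Lemma act1M (f : Mor C) : fM act ((inj1, inj1), f) = f.
Proof. exact: is_action1M (actP C) f. Qed.

Lemma actMO (u v : inj) (x : Ob C) : act (u, act (v, x)) = act (injM u v, x).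
Proof. exact: is_actionMO (actP C) u v x. Qed.

Lemma actMM (v u v' u' : inj) (f : Mor C) :
  fM act ((v, u), fM act ((v', u'), f)) = fM act ((injM v v', injM u u'), f).
Proof. exact: is_actionMM (actP C) v u v' u' f. Qed.

Lemma src_act v u (f : Mor C) : src (fM act ((v, u), f)) = act (u, src f).
Proof. by rewrite src_fM. Qed.

Lemma tgt_act v u (f : Mor C) : tgt (fM act ((v, u), f)) = act (v, tgt f).
Proof. by rewrite tgt_fM. Qed.

Lemma act_compm w v u (g f : Mor C) (e : src g = tgt f) e' :
  fM act ((w, u), compm g f e) =
  compm (fM act ((w, v), g)) (fM act ((v, u), f)) e'.
Proof.
have e1 : @src (prodC EM C) ((w, v), g) = tgt (((v, u), f) : Mor (prodC EM C)).
  by rewrite /= e.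
rewrite -(@fM_compm _ _ act ((w, v), g) ((v, u), f) e1).
by congr (fM act (_, _)); exact: compm_eq.
Qed.

Lemma act_idm u (x : Ob C) : fM act ((u, u), idm x) = idm (act (u, x)).
Proof. by rewrite -(fM_idm act (u, x)). Qed.

Lemma act_ok v u u' w (g f : Mor C) (e : src g = tgt f) : u = u' ->
  src (fM act ((v, u), g)) = tgt (fM act ((u', w), f)).
Proof. by move=> <-; rewrite src_act tgt_act e. Qed.

End ActLemmas.

Definition supported (C : Mcat) (A : set nat) (x : Ob C) : Prop :=
  forall u : inj, (forall n, A n -> u n = n) -> act (u, x) = x.

Definition fin_supported (C : Mcat) (x : Ob C) : Prop :=
  exists A : set nat, finite_set A /\ supported A x.

Definition tame (C : Mcat) : Prop := forall x : Ob C, fin_supported x.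

(* The supporting sets have to be finite: the only injection fixing all but one
   point of nat is the identity, so that every object whatsoever is supported
   on the complement of a point. For finitely supported x and y this says that
   the minimal finite supports of x and y are disjoint. *)
Definition disjoint_supp (C D : Mcat) (x : Ob C) (y : Ob D) : Prop :=
  exists A B : set nat, [/\ finite_set A, finite_set B,
    A `&` B = set0, supported A x & supported B y].

Definition extend_fun (f : nat -> nat) (s : seq nat) :
  {in s &, injective f} ->
  exists u v : inj, [/\ injM u v = inj1, injM v u = inj1 &
    forall n, n \in s -> u n = f n].
Proof.
elim: s => [|a s IH] fi.
  by exists inj1, inj1; split=> //; exact: inj_eq_ext.
have [u [v [uv vu us]]] : exists u v : inj, [/\ injM u v = inj1,
    injM v u = inj1 & forall n, n \in s -> u n = f n].
  by apply: IH => x y xs ys; apply: fi; rewrite inE ?xs ?ys orbT.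
pose sw n := if n == u a then f a else if n == f a then u a else n.
have swK : cancel sw sw.
  move=> n; rewrite /sw; case: (eqVneq n (u a)) => [->|na].
    by case: (eqVneq (f a) (u a)) => // _; rewrite eqxx.
  case: (eqVneq n (f a)) => [->|nf]; first by rewrite eqxx.
  by rewrite (negbTE na) (negbTE nf).
pose s1 := Inj (can_inj swK).
have s11 : injM s1 s1 = inj1 by apply: inj_eq_ext.
exists (injM s1 u), (injM v s1); split.
- by rewrite -injMA (injMA u) uv inj1M.
- by rewrite -injMA (injMA s1) s11 inj1M.
- move=> n; rewrite inE => /orP[/eqP ->|ns] /=; first by rewrite /sw eqxx.
  rewrite /sw; case: (eqVneq (u n) (u a)) => [/inj_injective -> //|una].
  case: (eqVneq (u n) (f a)) => [e|]; last by rewrite us.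
  have na : n = a by apply: fi; rewrite ?inE ?ns ?eqxx ?orbT // -us.
  by rewrite na eqxx in una.
Qed.

Section Supports.
Variable C : Mcat.
Implicit Types (x : Ob C) (A B : set nat).

Lemma supported_agree A x (u v : inj) : finite_set A -> supported A x ->
  (forall n, A n -> u n = v n) -> act (u, x) = act (v, x).
Proof.
move=> /finite_seqP[s ->] sx uv.
have [p [q [pq qp ps]]] : exists p q : inj, [/\ injM p q = inj1,
    injM q p = inj1 & forall n, n \in s -> p n = u n].
  by apply: extend_fun => a b _ _; exact: inj_injective.
have H (w : inj) : (forall n, n \in s -> w n = u n) -> act (w, x) = act (p, x).
  move=> wu; rewrite -[w]inj1M -pq -injMA -actMO (sx (injM q w)) // => n ns /=.
  by rewrite wu // -ps // -[q (p n)]/(injM q p n) qp.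
by rewrite (H u) // (H v) // => n ns; rewrite uv.
Qed.

Lemma supported_act A x (u : inj) : finite_set A -> supported A x ->
  supported (u @` A) (act (u, x)).
Proof.
move=> fA sx v vA; rewrite actMO; apply: (supported_agree fA sx) => n An /=.
by apply: vA; exists n.
Qed.

Lemma supported_sub A B x : A `<=` B -> supported A x -> supported B x.
Proof. by move=> AB sx u uB; apply: sx => n /AB; exact: uB. Qed.

Lemma supported_fin A x : finite_set A -> supported A x -> fin_supported x.
Proof. by exists A. Qed.

Lemma supportedI A B x : finite_set A -> finite_set B ->
  supported A x -> supported B x -> supported (A `&` B) x.
Proof.
move=> fA fB; case/finite_seqP: (fA) => s As; case/finite_seqP: (fB) => t Bt.
move=> sA sB v vAB.
pose N := (\max_(n <- s ++ t) n + \max_(n <- s) v n).+1.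
have Ns n : n \in s -> n < N.
  move=> ns; rewrite ltnS (leq_trans _ (leq_addr _ _)) //.
  by rewrite leq_bigmax_seq // mem_cat ns.
have Nt n : n \in t -> n < N.
  move=> ns; rewrite ltnS (leq_trans _ (leq_addr _ _)) //.
  by rewrite leq_bigmax_seq // mem_cat ns orbT.
have Nv n : n \in s -> v n < N.
  move=> ns; rewrite ltnS (leq_trans _ (leq_addl _ _)) //.
  exact: (leq_bigmax_seq n (F := v)) ns isT.
pose f n := if n \in t then n else n + N.
have [p [_ [_ _ pf]]] : exists p q : inj, [/\ injM p q = inj1,
    injM q p = inj1 & forall n, n \in s ++ t -> p n = f n].
  apply: extend_fun => a b _ _; rewrite /f.
  case: ifP => at_; case: ifP => bt //.
  - by move=> e; have := Nt _ at_; rewrite e ltnNge leq_addl.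
  - by move=> e; have := Nt _ bt; rewrite -e ltnNge leq_addl.
  - exact: addIn.
pose g n := if n \in s then v n else n.
have [q [_ [_ _ qg]]] : exists p q : inj, [/\ injM p q = inj1,
    injM q p = inj1 & forall n, n \in s ++ map f s -> p n = g n].
  apply: extend_fun => a b.
  have H c : c \in s ++ map f s -> c \notin s -> N <= c.
    rewrite mem_cat => /orP[-> //|/mapP[d ds ->]]; rewrite /f.
    by case: ifP => dt; [rewrite ds | rewrite leq_addl].
  move=> ha hb; rewrite /g; case: ifPn => as_; case: ifPn => bs //.
  - exact: inj_injective.
  - by move=> e; have := H _ hb bs; rewrite -e leqNgt Nv.
  - by move=> e; have := H _ ha as_; rewrite e leqNgt Nv.
have px : act (p, x) = x.
  apply: sB => n; rewrite Bt /= => nt.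
  by rewrite pf ?mem_cat ?nt ?orbT // /f nt.
have qv : act (q, x) = act (v, x).
  apply: (supported_agree fA sA) => n; rewrite As /= => ns.
  by rewrite qg ?mem_cat ?ns // /g ns.
rewrite -qv -{1}px actMO -[RHS]px; apply: (supported_agree fA sA) => n.
rewrite As /= => ns; rewrite pf ?mem_cat ?ns // qg; last first.
  by rewrite mem_cat map_f ?orbT.
rewrite /g /f; case: (boolP (n \in t)) => nt.
  by rewrite ns; apply: vAB; split; rewrite ?As ?Bt.
by case: ifP => // /Ns; rewrite ltnNge leq_addl.
Qed.

End Supports.

Lemma disjoint_supp_act (C D : Mcat) (u : inj) (x : Ob C) (y : Ob D) :
  disjoint_supp x y -> disjoint_supp (act (u, x)) (act (u, y)).
Proof.
move=> [A [B [fA fB AB sx sy]]]; exists (u @` A), (u @` B).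
split; try exact: finite_image; try exact: supported_act.
rewrite -subset0 => n [[a Aa <-] [b Bb ub]].
have : (A `&` B) a by split=> //; rewrite -(inj_injective ub).
by rewrite AB.
Qed.

Lemma fin_supported_act (C : Mcat) (u : inj) (x : Ob C) :
  fin_supported x -> fin_supported (act (u, x)).
Proof.
move=> [A [fA sx]]; exists (u @` A).
by split; [exact: finite_image | exact: supported_act].
Qed.

Lemma disjoint_supp_map (C D : Mcat) (F : functor C D) (hF : equivariant F)
  (x y : Ob C) : disjoint_supp x y -> disjoint_supp (F x) (F y).
Proof.
have H A z : supported A z -> supported A (F z).
  by move=> sz u uA; rewrite -(eqvO hF) sz.
by move=> [A [B [fA fB AB sx sy]]]; exists A, B; split=> //; exact: H.
Qed.

Lemma full_act (C : Mcat) (P : Ob C -> Prop)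
  (PM : forall u x, P x -> P (act (u, x))) v u f :
  sM (full P) f -> sM (full P) (fM act ((v, u), f)).
Proof. by move=> [h1 h2]; split; rewrite ?src_act ?tgt_act; exact: PM. Qed.

Program Definition full_actF (C : Mcat) (P : Ob C -> Prop)
  (PM : forall u x, P x -> P (act (u, x))) :
  functor (prodC EM (subcat (full P))) (subcat (full P)) :=
  @Functor (prodC EM (subcat (full P))) (subcat (full P))
  (fun p => exist _ (act (p.1, sval p.2)) (PM p.1 _ (svalP p.2)))
  (fun p => exist _ (fM act ((p.1.1, p.1.2), sval p.2))
     (full_act PM p.1.1 p.1.2 (svalP p.2))) _.
Next Obligation.
move=> C P PM; split.
- by move=> [[v u] f]; apply: sig_eq; exact: src_act.
- by move=> [[v u] f]; apply: sig_eq; exact: tgt_act.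
- by move=> [u x]; apply: sig_eq; exact: act_idm.
- move=> [[w v] g] [[v' u] f] e e'; apply: sig_eq => /=.
  have ev : v = v' := eq_fst e.
  by subst v'; exact: act_compm.
Qed.

Program Definition fullM (C : Mcat) (P : Ob C -> Prop)
  (PM : forall u x, P x -> P (act (u, x))) : Mcat :=
  @MCat (subcat (full P)) (full_actF PM) _.
Next Obligation.
move=> C P PM; split.
- by move=> x; apply: sig_eq; exact: act1O.
- by move=> x; apply: sig_eq; exact: act1M.
- by move=> u v x; apply: sig_eq; exact: actMO.
- by move=> v u v' u' f; apply: sig_eq; exact: actMM.
Qed.

Definition tame_part (C : Mcat) : Mcat :=
  fullM (P := @fin_supported C) (@fin_supported_act C).

Program Definition prod_act (C D : Mcat) :
  functor (prodC EM (prodC C D)) (prodC C D) :=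
  @Functor (prodC EM (prodC C D)) (prodC C D)
  (fun p => (act (p.1, p.2.1), act (p.1, p.2.2)))
  (fun p => (fM act (p.1, p.2.1), fM act (p.1, p.2.2))) _.
Next Obligation.
move=> C D; split.
- by move=> [[v u] [f g]]; rewrite /= !src_act.
- by move=> [[v u] [f g]]; rewrite /= !tgt_act.
- by move=> [u [x y]]; rewrite /= !act_idm.
- move=> [[w v] [g g']] [[v' u] [f f']] e e' /=.
  have ev : v = v' := eq_fst e.
  by subst v'; congr pair; exact: act_compm.
Qed.

Program Definition prodM (C D : Mcat) : Mcat :=
  @MCat (prodC C D) (prod_act C D) _.
Next Obligation.
move=> C D; split.
- by move=> [x y]; rewrite /= !act1O.
- by move=> [x y]; rewrite /= !act1M.
- by move=> u v [x y]; rewrite /= !actMO.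
- by move=> v u v' u' [f g]; rewrite /= !actMM.
Qed.

Definition box (C D : Mcat) : Mcat :=
  @fullM (prodM C D) (fun p => disjoint_supp p.1 p.2)
    (fun u p => @disjoint_supp_act C D u p.1 p.2).

Definition mdisjoint (C D : Mcat) (f : Mor C) (g : Mor D) : Prop :=
  disjoint_supp (src f) (src g) /\ disjoint_supp (tgt f) (tgt g).

Definition plusO (C : Mcat) (P : functor (box C C) C) (x y : Ob C)
  (h : disjoint_supp x y) : Ob C := P (exist _ (x, y) h).

Definition plusM (C : Mcat) (P : functor (box C C) C) (f g : Mor C)
  (h : mdisjoint f g) : Mor C := fM P (exist _ (f, g) h).

(* In the associativity axioms the disjointness of x + y and z and that of x and
   y + z follow from the pairwise disjointness of x, y and z
   (see disjoint_plus below), so assuming them is no restriction. *)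
Record parsummable := Parsummable {
  pc :> Mcat;
  pc_tame : tame pc;
  zero : Ob pc;
  plus : functor (box pc pc) pc;
  act_zero : forall u, act (u, zero) = zero;
  plus_eqv : equivariant plus;
  plusO0 : forall x (h : disjoint_supp x zero), plusO plus h = x;
  plusM0 : forall f (h : mdisjoint f (idm zero)), plusM plus h = f;
  plus0O : forall x (h : disjoint_supp zero x), plusO plus h = x;
  plus0M : forall f (h : mdisjoint (idm zero) f), plusM plus h = f;
  plusOC : forall x y (h : disjoint_supp x y) (h' : disjoint_supp y x),
    plusO plus h = plusO plus h';
  plusMC : forall f g (h : mdisjoint f g) (h' : mdisjoint g f),
    plusM plus h = plusM plus h';
  plusOA : forall x y z (xy : disjoint_supp x y) (yz : disjoint_supp y z)
    (xz : disjoint_supp x z)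
    (xy_z : disjoint_supp (plusO plus xy) z)
    (x_yz : disjoint_supp x (plusO plus yz)),
    plusO plus xy_z = plusO plus x_yz;
  plusMA : forall f g h (fg : mdisjoint f g) (gh : mdisjoint g h)
    (fh : mdisjoint f h)
    (fg_h : mdisjoint (plusM plus fg) h)
    (f_gh : mdisjoint f (plusM plus gh)),
    plusM plus fg_h = plusM plus f_gh
}.
Arguments zero {p}.
Arguments plus {p}.

Lemma supported_plus (C : parsummable) (A B : set nat) (x y : Ob C)
  (h : disjoint_supp x y) : supported A x -> supported B y ->
  supported (A `|` B) (plusO plus h).
Proof.
move=> sx sy u uAB; rewrite /plusO -(eqvO (plus_eqv C)); congr (plus _).
apply: sig_eq => /=; rewrite sx ?sy // => n hn; apply: uAB; by [left|right].
Qed.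

Lemma disjoint_plus (C : parsummable) (x y z : Ob C) (xy : disjoint_supp x y) :
  disjoint_supp x z -> disjoint_supp y z -> disjoint_supp (plusO plus xy) z.
Proof.
move=> [A [D [fA fD AD sx sz]]] [B [E [fB fE BE sy sz']]].
exists (A `|` B), (D `&` E); split.
- by rewrite finite_setU.
- exact: finite_setIl.
- rewrite -subset0 => n [[An|Bn] [Dn En]]; first by rewrite -AD.
  by rewrite -BE.
- exact: supported_plus.
- exact: supportedI.
Qed.

Lemma mdisjoint_map (C D : Mcat) (F : functor C D) (hF : equivariant F)
  (f g : Mor C) : mdisjoint f g -> mdisjoint (fM F f) (fM F g).
Proof.
by move=> [h1 h2]; split; rewrite ?src_fM ?tgt_fM; exact: disjoint_supp_map.
Qed.

Record parsum_morphism (C D : parsummable) (F : functor C D) : Prop :=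
  ParsumMorphism {
    pm_eqv : equivariant F;
    pm_zero : F zero = zero;
    pm_plusO : forall x y (h : disjoint_supp x y),
      F (plusO plus h) = plusO plus (disjoint_supp_map pm_eqv h);
    pm_plusM : forall f g (h : mdisjoint f g),
      fM F (plusM plus h) = plusM plus (mdisjoint_map pm_eqv h)
  }.

Section CatM.
Variable C : Mcat.

Program Definition catM_actO (u : inj) (X : functor EM C) : functor EM C :=
  @Functor EM C (fun w => act (u, X (injM w u)))
  (fun p => fM act ((u, u), fM X (injM p.1 u, injM p.2 u))) _.
Next Obligation.
move=> u X; split.
- by move=> [w v]; rewrite /= src_act src_fM.
- by move=> [w v]; rewrite /= tgt_act tgt_fM.
- by move=> w; rewrite /= -act_idm -fM_idm.
- move=> [a b] [b' c] /= e e'; subst b'.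
  have e1 : @src EM (injM a u, injM b u) = tgt ((injM b u, injM c u) : Mor EM).
    by [].
  have e2 : src (fM X (injM a u, injM b u)) = tgt (fM X (injM b u, injM c u)).
    by rewrite src_fM tgt_fM.
  have -> : (injM a u, injM c u) = @compm EM _ _ e1 by [].
  by rewrite (fM_compm e1 e2); exact: act_compm.
Qed.

Lemma catM_act_ok (u' u : inj) (T : nattrans EM C) (w : inj) :
  src (fM (nttgt T) (injM w u', injM w u)) = tgt (T (injM w u)).
Proof. by rewrite src_fM tgt_ntc. Qed.

(* At w, the transformation (u', u) . T is
     [u', u]^Y o u_* T  =  u'_*(Y (wu', wu)) o [u', u]^(Y (wu)) o u_*(T (wu))
   for T : X -> Y; see the lemmas catM_bracket and catM_uM. *)
Program Definition catM_actM (u' u : inj) (T : nattrans EM C) : nattrans EM C :=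
  @NatTrans EM C (catM_actO u (ntsrc T)) (catM_actO u' (nttgt T))
  (fun w => fM act ((u', u), compm (fM (nttgt T) (injM w u', injM w u))
     (T (injM w u)) (catM_act_ok u' u T w))) _.
Next Obligation.
move=> u' u T; split.
- by move=> w; rewrite src_act src_compm src_ntc.
- by move=> w; rewrite tgt_act tgt_compm tgt_fM.
- move=> [w v] /= e e'.
  have a1 : src (compm (fM (nttgt T) (injM w u', injM w u)) (T (injM w u))
     (catM_act_ok u' u T w)) = tgt (fM (ntsrc T) (injM w u, injM v u)).
    by rewrite src_compm src_ntc tgt_fM.
  rewrite -(act_compm a1).
  have a2 : src (fM (nttgt T) (injM w u', injM v u')) =
      tgt (compm (fM (nttgt T) (injM v u', injM v u)) (T (injM v u))
     (catM_act_ok u' u T v)).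
    by rewrite tgt_compm src_fM tgt_fM.
  rewrite -(act_compm a2); congr (fM act (_, _)).
  have b1 : src (T (injM w u)) = tgt (fM (ntsrc T) (injM w u, injM v u)).
    by rewrite src_ntc tgt_fM.
  have b2 : src (fM (nttgt T) (injM w u', injM w u)) = tgt (compm _ _ b1).
    by rewrite tgt_compm src_fM tgt_ntc.
  rewrite (compmA _ b1 _ b2).
  have b3 : src (fM (nttgt T) (injM w u, injM v u)) = tgt (T (injM v u)).
    by rewrite src_fM tgt_ntc.
  have b4 : src (fM (nttgt T) (injM w u', injM w u)) = tgt (compm _ _ b3).
    by rewrite tgt_compm src_fM tgt_fM.
  rewrite (compm_eq b2 b4 erefl (@ntc_nat _ _ T (injM w u, injM v u) b1 b3)).
  have b5 : src (fM (nttgt T) (injM w u', injM w u)) =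
      tgt (fM (nttgt T) (injM w u, injM v u)) by rewrite src_fM tgt_fM.
  have b6 : src (compm _ _ b5) = tgt (T (injM v u)).
    by rewrite src_compm src_fM tgt_ntc.
  rewrite -(compmA b5 _ b6 _).
  have b7 : src (fM (nttgt T) (injM w u', injM v u')) =
      tgt (fM (nttgt T) (injM v u', injM v u)) by rewrite src_fM tgt_fM.
  have b8 : src (compm _ _ b7) = tgt (T (injM v u)).
    by rewrite src_compm src_fM tgt_ntc.
  rewrite -(compmA b7 _ b8 _); apply: compm_eq => //.
  have c1 : @src EM (injM w u', injM w u) = tgt ((injM w u, injM v u) : Mor EM).
    by [].
  have c2 : @src EM (injM w u', injM v u') =
      tgt ((injM v u', injM v u) : Mor EM).
    by [].
  by rewrite -(fM_compm c1) -(fM_compm c2).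
Qed.

Lemma fM_EM_id (X : functor EM C) w : fM X (w, w) = idm (X w).
Proof. by rewrite -fM_idm. Qed.

Lemma catM_actOM u v (X : functor EM C) :
  catM_actO u (catM_actO v X) = catM_actO (injM u v) X.
Proof.
apply: functor_eq => [w|[w z]] /=.
  by rewrite actMO injMA.
by rewrite actMM !injMA.
Qed.

Lemma catM_actO1 (X : functor EM C) : catM_actO inj1 X = X.
Proof.
by apply: functor_eq => [w|[w z]] /=; rewrite ?act1O ?act1M !injM1.
Qed.

Lemma catM_actM_comp (u'' u' u : inj) (T S : nattrans EM C)
  (e : ntsrc T = nttgt S)
  (e' : ntsrc (catM_actM u'' u' T) = nttgt (catM_actM u' u S)) :
  catM_actM u'' u (compnt e) = compnt e'.
Proof.
apply: nattrans_eq => //= w.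
set a := compm _ _ _; set b := compm (fM (nttgt T) _) _ _.
set c := compm (fM (nttgt S) _) _ _.
have a1 : src b = tgt c.
  by rewrite src_compm tgt_compm src_ntc tgt_fM e.
rewrite -(act_compm a1); congr (fM act (_, _)); rewrite /a /b /c.
have b1 : src (T (injM w u')) = tgt (fM (ntsrc T) (injM w u', injM w u)).
  by rewrite src_ntc tgt_fM.
have b2 : src (fM (nttgt T) (injM w u', injM w u)) = tgt (T (injM w u)).
  by rewrite src_fM tgt_ntc.
have h1 := @ntc_nat _ _ T (injM w u', injM w u) b1 b2.
have c1 : src (T (injM w u')) = tgt (compm (fM (nttgt S) (injM w u', injM w u))
   (S (injM w u)) (catM_act_ok u' u S w)).
  by rewrite tgt_compm src_ntc tgt_fM e.
have c2 : src (fM (nttgt T) (injM w u'', injM w u')) = tgt (compm _ _ c1).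
  by rewrite tgt_compm src_fM tgt_ntc.
rewrite (compmA _ c1 _ c2).
have c3 : src (T (injM w u')) = tgt (fM (nttgt S) (injM w u', injM w u)).
  by rewrite src_ntc tgt_fM e.
have c4 : src (compm _ _ c3) = tgt (S (injM w u)).
  by rewrite src_compm src_fM tgt_ntc.
have h2 := compmA c3 _ c4 c1.
have c5 : src (compm _ _ b2) = tgt (S (injM w u)).
  by rewrite src_compm src_ntc tgt_ntc e.
have h3 : compm _ _ c4 = compm _ _ c5.
  apply: compm_eq => //; rewrite -h1; apply: compm_eq => //.
  by rewrite e.
have c6 : src (fM (nttgt T) (injM w u'', injM w u')) = tgt (compm _ _ c5).
  by rewrite !tgt_compm src_fM tgt_fM.
rewrite (compm_eq c2 c6 erefl (etrans (esym h2) h3)).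
have c7 : src (T (injM w u)) = tgt (S (injM w u)) by rewrite src_ntc tgt_ntc e.
have c8 : src (fM (nttgt T) (injM w u', injM w u)) = tgt (compm _ _ c7).
  by rewrite tgt_compm.
have c9 : src (fM (nttgt T) (injM w u'', injM w u')) = tgt (compm _ _ c8).
  by rewrite tgt_compm src_fM tgt_fM.
rewrite (compm_eq c6 c9 erefl (compmA b2 c7 c5 c8)).
have d1 : src (fM (nttgt T) (injM w u'', injM w u')) =
   tgt (fM (nttgt T) (injM w u', injM w u)) by rewrite src_fM tgt_fM.
have d2 : src (compm _ _ d1) = tgt (compm _ _ c7).
  by rewrite src_compm.
rewrite -(compmA d1 c8 d2 c9); apply: compm_eq; last exact: compm_eq.
have f1 : @src EM (injM w u'', injM w u') =
    tgt ((injM w u', injM w u) : Mor EM).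
  by [].
by rewrite -(fM_compm f1).
Qed.

Program Definition catM_act : functor (prodC EM (funcat EM C)) (funcat EM C) :=
  @Functor (prodC EM (funcat EM C)) (funcat EM C)
  (fun p => catM_actO p.1 p.2) (fun p => catM_actM p.1.1 p.1.2 p.2) _.
Next Obligation.
split => //.
- move=> [u X]; apply: nattrans_eq => //= w.
  rewrite -act_idm; congr (fM act (_, _)).
  by rewrite compm1r fM_EM_id.
- move=> [[u'' u'] T] [[v' u] S] e e'.
  have ev : u' = v' := eq_fst e.
  by subst v'; exact: catM_actM_comp.
Qed.

Program Definition catM : Mcat :=
  @MCat (funcat EM C) catM_act _.
Next Obligation.
split.
- by move=> X; exact: catM_actO1.
- move=> T; apply: nattrans_eq => /=; try exact: catM_actO1.
  move=> w; rewrite act1M; apply: compm_idl; last by rewrite injM1.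
  exact: fM_EM_id.
- by move=> u v X; exact: catM_actOM.
- move=> v u v' u' T; apply: nattrans_eq => /=; try exact: catM_actOM.
  move=> w.
  pose g := fM (nttgt T) (injM (injM w v) v', injM (injM w u) v').
  pose f := compm (fM (nttgt T) (injM (injM w u) v', injM (injM w u) u'))
    (T (injM (injM w u) u')) (catM_act_ok v' u' T (injM w u)).
  have gf : src g = tgt f by rewrite /g /f tgt_compm src_fM tgt_fM.
  have gf' : src (fM act ((v', v'), g)) = tgt (fM act ((v', u'), f)).
    exact: act_ok.
  transitivity (fM act ((v, u), fM act ((v', u'), compm g f gf))).
    congr (fM act (_, _)); rewrite (act_compm gf gf'); exact: compm_eq.
  rewrite actMM; congr (fM act (_, _)); rewrite /f.
  have d1 : src g = tgt (fM (nttgt T) (injM (injM w u) v', injM (injM w u) u')).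
    by rewrite /g src_fM tgt_fM.
  have d2 : src (compm _ _ d1) = tgt (T (injM (injM w u) u')).
    by rewrite src_compm src_fM tgt_ntc.
  rewrite -(compmA d1 _ d2 _); apply: compm_eq; last by rewrite injMA.
  have f1 : @src EM (injM (injM w v) v', injM (injM w u) v') =
      tgt ((injM (injM w u) v', injM (injM w u) u') : Mor EM) by [].
  by rewrite -(fM_compm f1) /= !injMA.
Qed.

End CatM.

Lemma catM_bracket (C : Mcat) (u' u w : inj) (X : functor EM C)
  (e : src (uM u' (fM X (injM w u', injM w u))) =
       tgt (bracket u' u (X (injM w u)))) :
  (bracket u' u (X : Ob (catM C)) : nattrans EM C) w = compm _ _ e.
Proof.
have e1 : src (fM X (injM w u', injM w u)) = tgt (idm (X (injM w u))).
  by rewrite src_fM tgt_idm.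
by rewrite -[RHS](act_compm e1) /=; congr (fM act (_, _)); exact: compm_eq.
Qed.

Lemma catM_uM (C : Mcat) (u w : inj) (T : nattrans EM C) :
  (uM u (T : Mor (catM C)) : nattrans EM C) w = uM u (T (injM w u)).
Proof.
rewrite /uM /=; congr (fM act (_, _)).
by apply: compm_idl => //; exact: fM_EM_id.
Qed.

Definition satM (C : Mcat) : Mcat := tame_part (catM C).

Lemma supported_at (C : Mcat) (A : set nat) (X : functor EM C) (w : inj) :
  tame C -> finite_set A -> supported A (X : Ob (catM C)) ->
  supported A (X w).
Proof.
move=> tC fA sX; case/finite_seqP: (fA) => s As.
pose N := (\max_(n <- s) n).+1.
have Ns n : n \in s -> n < N by move=> ns; rewrite ltnS leq_bigmax_seq.
have NsN n m : n \in s -> N <= m -> n <> m.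
  by move=> /Ns ns Nm e; rewrite e ltnNge Nm in ns.
have H (b : bool) : exists B : set nat, [/\ finite_set B,
    supported B (X w) & forall n, B n -> A n \/ (N <= n /\ odd n = b)].
  pose u0 n := if n \in s then n else b + (n + N).*2.
  have Nu n : N <= b + (n + N).*2.
    apply: leq_trans (leq_addl _ _); rewrite -addnn.
    by apply: leq_trans (leq_addl _ _); exact: leq_addl.
  have u0i : injective u0.
    move=> m n; rewrite /u0; case: ifP => ms; case: ifP => ns //.
    - by move=> /(NsN _ _ ms (Nu _)).
    - by move=> /esym/(NsN _ _ ns (Nu _)).
    - by move=> /addnI/double_inj/addIn.
  pose u := Inj u0i.
  have uX : X w = act (u, X (injM w u)).
    have e : catM_actO u X = X.
      by apply: (sX u) => n; rewrite As /= /u0 => ->.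
    by rewrite -[in LHS]e.
  have [D [fD sD]] := tC (X (injM w u)).
  exists (u @` D); split; first exact: finite_image.
    by rewrite uX; exact: supported_act.
  move=> _ [d _ <-] /=; rewrite As /u0; case: ifP => ds; first by left.
  by right; split=> //; rewrite oddD odd_double addbF; case: (b).
have [B [fB sB hB]] := H true; have [D [fD sD hD]] := H false.
apply: supported_sub (supportedI fB fD sB sD) => n [/hB[//|[_ o]] /hD[//|[_]]].
by rewrite o.
Qed.

Section SatParsum.
Variable C : parsummable.
Let S := satM C.

Lemma supported_sval (P : Ob (catM C) -> Prop)
  (PM : forall u x, P x -> P (act (u, x))) (A : set nat)
  (X : Ob (fullM PM)) :
  supported A X <-> supported A (sval X).
Proof.
split=> sX u uA; first by rewrite -[RHS](eq_sval (sX u uA)).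
by apply: sig_eq; exact: sX.
Qed.

Lemma sat_disjoint (X Y : Ob S) (h : disjoint_supp X Y) (w : inj) :
  disjoint_supp ((sval X : functor EM C) w) ((sval Y : functor EM C) w).
Proof.
move: h => [A [B [fA fB AB sX sY]]]; exists A, B; split=> //.
- by apply: supported_at fA _; [exact: pc_tame | exact/supported_sval].
- by apply: supported_at fB _; [exact: pc_tame | exact/supported_sval].
Qed.

Lemma sat_mdisjoint (X Y : Ob S) (h : disjoint_supp X Y) (f : Mor EM) :
  mdisjoint (fM (sval X : functor EM C) f) (fM (sval Y : functor EM C) f).
Proof. by split; rewrite ?src_fM ?tgt_fM; exact: sat_disjoint. Qed.

Lemma sat_ntdisjoint (T U : Mor S) (h : mdisjoint T U) (w : inj) :
  mdisjoint ((sval T : nattrans EM C) w) ((sval U : nattrans EM C) w).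
Proof.
by case: h => h1 h2; split; rewrite ?src_ntc ?tgt_ntc;
  [exact: (sat_disjoint h1) | exact: (sat_disjoint h2)].
Qed.

Lemma plusO_eq (x y x' y' : Ob C) (h : disjoint_supp x y)
  (h' : disjoint_supp x' y') :
  x = x' -> y = y' -> plusO plus h = plusO plus h'.
Proof. by move=> *; subst; rewrite (Prop_irrelevance h h'). Qed.

Lemma plusM_eq (x y x' y' : Mor C) (h : mdisjoint x y)
  (h' : mdisjoint x' y') :
  x = x' -> y = y' -> plusM plus h = plusM plus h'.
Proof. by move=> *; subst; rewrite (Prop_irrelevance h h'). Qed.

Lemma src_plusM (f g : Mor C) (h : mdisjoint f g)
  (h' : disjoint_supp (src f) (src g)) : src (plusM plus h) = plusO plus h'.
Proof. by rewrite /plusM src_fM; congr (plus _); exact: sig_eq. Qed.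

Lemma tgt_plusM (f g : Mor C) (h : mdisjoint f g)
  (h' : disjoint_supp (tgt f) (tgt g)) : tgt (plusM plus h) = plusO plus h'.
Proof. by rewrite /plusM tgt_fM; congr (plus _); exact: sig_eq. Qed.

Lemma plusM_idm (x y : Ob C) (h : mdisjoint (idm x) (idm y))
  (h' : disjoint_supp x y) : plusM plus h = idm (plusO plus h').
Proof. by rewrite /plusO -fM_idm; congr (fM plus _); exact: sig_eq. Qed.

Lemma plusM_compm (f f' g g' : Mor C) (e : src f = tgt f')
  (e' : src g = tgt g') (h1 : mdisjoint (compm f f' e) (compm g g' e'))
  (h : mdisjoint f g) (h' : mdisjoint f' g') e'' :
  plusM plus h1 = compm (plusM plus h) (plusM plus h') e''.
Proof.
have k : @src (box C C) (exist _ (f, g) h) =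
    tgt (exist _ (f', g') h' : Mor (box C C)).
  by apply: sig_eq; rewrite /= e e'.
rewrite -(fM_compm k); congr (fM plus _); apply: sig_eq => /=.
by congr pair; exact: compm_eq.
Qed.

Lemma act_plusO u (x y : Ob C) (h : disjoint_supp x y) h' :
  act (u, plusO plus h) = @plusO C plus (act (u, x)) (act (u, y)) h'.
Proof. by rewrite -(eqvO (plus_eqv C)); congr (plus _); exact: sig_eq. Qed.

Lemma act_plusM p (f g : Mor C) (h : mdisjoint f g) h' :
  fM act (p, plusM plus h) =
  @plusM C plus (fM act (p, f)) (fM act (p, g)) h'.
Proof.
case: p h' => v u h'.
by rewrite -(eqvM (plus_eqv C)); congr (fM plus _); exact: sig_eq.
Qed.

Program Definition sat_plusF (X Y : Ob S) (h : disjoint_supp X Y) :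
  functor EM C :=
  @Functor EM C (fun w => plusO plus (sat_disjoint h w))
  (fun p => plusM plus (sat_mdisjoint h p)) _.
Next Obligation.
move=> X Y h; split.
- move=> p; rewrite (src_plusM _ (proj1 (sat_mdisjoint h p))).
  by apply: plusO_eq; exact: src_fM.
- move=> p; rewrite (tgt_plusM _ (proj2 (sat_mdisjoint h p))).
  by apply: plusO_eq; exact: tgt_fM.
- move=> w.
  have k : mdisjoint (idm ((sval X : functor EM C) w))
                     (idm ((sval Y : functor EM C) w)).
    by split; rewrite ?src_idm ?tgt_idm; exact: sat_disjoint.
  by rewrite -(plusM_idm k); apply: plusM_eq; exact: fM_idm.
- move=> g f e e'.
  have k1 : src (fM (sval X : functor EM C) g) =
      tgt (fM (sval X : functor EM C) f).
    by rewrite src_fM tgt_fM e.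
  have k2 : src (fM (sval Y : functor EM C) g) =
      tgt (fM (sval Y : functor EM C) f).
    by rewrite src_fM tgt_fM e.
  have k3 : mdisjoint (compm _ _ k1) (compm _ _ k2).
    by rewrite -(fM_compm e k1) -(fM_compm e k2); exact: sat_mdisjoint.
  rewrite -(plusM_compm k3); apply: plusM_eq; exact: fM_compm.
Qed.

Lemma sat_plusF_act u (X Y : Ob S) (h : disjoint_supp X Y)
  (h' : disjoint_supp (act (u, X)) (act (u, Y))) :
  catM_actO u (sat_plusF h) = sat_plusF h'.
Proof.
apply: functor_eq => [w|p] /=.
  rewrite act_plusO => [|k]; last exact: plusO_eq.
  exact: disjoint_supp_act (sat_disjoint _ _).
rewrite act_plusM => [|k]; last exact: plusM_eq.
exact: (sat_mdisjoint h' p).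
Qed.

Lemma sat_plusF_eq (X Y X' Y' : Ob S) (h : disjoint_supp X Y)
  (h' : disjoint_supp X' Y') : X = X' -> Y = Y' -> sat_plusF h = sat_plusF h'.
Proof. by move=> *; subst; rewrite (Prop_irrelevance h h'). Qed.

Lemma sat_plusF_supp (X Y : Ob S) (h : disjoint_supp X Y) :
  fin_supported (sat_plusF h : Ob (catM C)).
Proof.
have [A [B [fA fB AB sX sY]]] := h; exists (A `|` B).
split; first by rewrite finite_setU.
move=> u uAB; rewrite -[LHS]/(catM_actO u (sat_plusF h)).
rewrite (sat_plusF_act h (disjoint_supp_act u h)).
by apply: sat_plusF_eq; [apply: sX | apply: sY] => n ?; apply: uAB;
  [left|right].
Qed.

Program Definition sat_plusN (T U : Mor S) (h : mdisjoint T U) :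
  nattrans EM C :=
  @NatTrans EM C (sat_plusF (proj1 h)) (sat_plusF (proj2 h))
  (fun w => plusM plus (sat_ntdisjoint h w)) _.
Next Obligation.
move=> T U h; split.
- move=> w; rewrite (src_plusM _ (proj1 (sat_ntdisjoint h w))).
  by apply: plusO_eq; exact: src_ntc.
- move=> w; rewrite (tgt_plusM _ (proj2 (sat_ntdisjoint h w))).
  by apply: plusO_eq; exact: tgt_ntc.
- move=> f e e'.
  have a1 : src ((sval T : nattrans EM C) (tgt f)) =
      tgt (fM (ntsrc (sval T)) f) by rewrite src_ntc tgt_fM.
  have a2 : src ((sval U : nattrans EM C) (tgt f)) =
      tgt (fM (ntsrc (sval U)) f) by rewrite src_ntc tgt_fM.
  have b1 : src (fM (nttgt (sval T)) f) =
      tgt ((sval T : nattrans EM C) (src f)) by rewrite tgt_ntc src_fM.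
  have b2 : src (fM (nttgt (sval U)) f) =
      tgt ((sval U : nattrans EM C) (src f)) by rewrite tgt_ntc src_fM.
  have a3 : mdisjoint (compm _ _ a1) (compm _ _ a2).
    split; rewrite ?src_compm ?tgt_compm ?src_fM ?tgt_ntc.
      exact: (sat_disjoint (proj1 h)).
    exact: (sat_disjoint (proj2 h)).
  have b3 : mdisjoint (compm _ _ b1) (compm _ _ b2).
    split; rewrite ?src_compm ?tgt_compm ?tgt_fM ?src_ntc.
      exact: (sat_disjoint (proj1 h)).
    exact: (sat_disjoint (proj2 h)).
  rewrite -(plusM_compm a3) -(plusM_compm b3).
  by apply: plusM_eq; exact: ntc_nat.
Qed.

Lemma sat_plusN_idm (X Y : Ob S) (T U : Mor S) (h : disjoint_supp X Y)
  (k : mdisjoint T U) : sval T = idnt (sval X) -> sval U = idnt (sval Y) ->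
  sat_plusN k = idnt (sat_plusF h).
Proof.
move=> eT eU; apply: nattrans_eq => /=.
- by apply: sat_plusF_eq; apply: sig_eq; rewrite /= ?eT ?eU.
- by apply: sat_plusF_eq; apply: sig_eq; rewrite /= ?eT ?eU.
- move=> w.
  have k' : mdisjoint (idm ((sval X : functor EM C) w))
                      (idm ((sval Y : functor EM C) w)).
    by split; rewrite ?src_idm ?tgt_idm; exact: (sat_disjoint h).
  by rewrite -(plusM_idm k'); apply: plusM_eq; rewrite ?eT ?eU.
Qed.

Lemma sat_plusN_comp (T U T1 U1 T2 U2 : Mor S) (h : mdisjoint T U)
  (h1 : mdisjoint T1 U1) (h2 : mdisjoint T2 U2)
  (eT : src T1 = tgt T2) (eU : src U1 = tgt U2)
  (e : ntsrc (sat_plusN h1) = nttgt (sat_plusN h2)) :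
  T = compm T1 T2 eT -> U = compm U1 U2 eU -> sat_plusN h = compnt e.
Proof.
move=> dT dU; subst T U; apply: nattrans_eq.
- exact: (sat_plusF_eq _ _ (src_compm _) (src_compm _)).
- exact: (sat_plusF_eq _ _ (tgt_compm _) (tgt_compm _)).
- move=> w.
  have a1 := nt_comp_ok (eq_sval eT) w; have a2 := nt_comp_ok (eq_sval eU) w.
  have k : mdisjoint (compm _ _ a1) (compm _ _ a2).
    split; rewrite ?src_compm ?tgt_compm.
      exact: (proj1 (sat_ntdisjoint h2 w)).
    exact: (proj2 (sat_ntdisjoint h1 w)).
  rewrite [RHS]/= -(plusM_compm k); apply: plusM_eq; exact: compm_eq.
Qed.

Lemma box_compm (D : Mcat) (g f : Mor (box D D)) (e : src g = tgt f) :
  exists e1 e2, sval (compm g f e) =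
    (compm (sval g).1 (sval f).1 e1, compm (sval g).2 (sval f).2 e2).
Proof. by exists (eq_fst (eq_sval e)), (eq_snd (eq_sval e)). Qed.

Program Definition sat_plus0 : functor (box S S) (funcat EM C) :=
  @Functor (box S S) (funcat EM C)
    (fun p => sat_plusF (svalP p)) (fun p => sat_plusN (svalP p)) _.
Next Obligation.
split.
- by move=> p; exact: (sat_plusF_eq _ _ erefl erefl).
- by move=> p; exact: (sat_plusF_eq _ _ erefl erefl).
- by move=> p; apply: sat_plusN_idm.
- move=> g f e e'; have [e1 [e2 E]] := box_compm e.
  exact: (sat_plusN_comp _ _ (f_equal fst E) (f_equal snd E)).
Qed.

Definition sat_plus : functor (box S S) S :=
  @corestr _ _ sat_plus0 (full (@fin_supported (catM C)))
    (fun p => sat_plusF_supp (svalP p))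
    (fun p => conj (sat_plusF_supp (proj1 (svalP p)))
                   (sat_plusF_supp (proj2 (svalP p)))).

Lemma sat_plusN_act v u (T U : Mor S) (h : mdisjoint T U)
  (h' : mdisjoint (fM act ((v, u), T)) (fM act ((v, u), U))) :
  catM_actM v u (sat_plusN h) = sat_plusN h'.
Proof.
apply: nattrans_eq.
- rewrite [LHS]/=; have k : disjoint_supp (act (u, src T)) (act (u, src U)).
    by apply: disjoint_supp_act; case: h.
  rewrite (sat_plusF_act _ k).
  by apply: sat_plusF_eq; rewrite src_act.
- rewrite [LHS]/=; have k : disjoint_supp (act (v, tgt T)) (act (v, tgt U)).
    by apply: disjoint_supp_act; case: h.
  rewrite (sat_plusF_act _ k).
  by apply: sat_plusF_eq; rewrite tgt_act.
- move=> w; rewrite [LHS]/= [RHS]/=; set a := compm _ _ _.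
  have c1 := catM_act_ok v u (sval T) w.
  have c2 := catM_act_ok v u (sval U) w.
  have k : mdisjoint (compm _ _ c1) (compm _ _ c2).
    split; rewrite ?src_compm ?tgt_compm.
      exact: (proj1 (sat_ntdisjoint h (injM w u))).
    exact: (proj2 (sat_mdisjoint (proj2 h) (injM w v, injM w u))).
  have -> : a = plusM plus k by rewrite /a; symmetry; exact: plusM_compm.
  have k' : mdisjoint (fM act ((v, u), compm _ _ c1))
                      (fM act ((v, u), compm _ _ c2)).
    by split; rewrite ?src_act ?tgt_act; apply: disjoint_supp_act; case: k.
  by rewrite (act_plusM _ k'); apply: plusM_eq;
    congr (fM act (_, _)); exact: compm_eq.
Qed.

Lemma sat_plus_eqv : equivariant sat_plus.
Proof.
split.
- by move=> u [[X Y] h]; apply: sig_eq; exact: (esym (sat_plusF_act _ _)).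
- move=> v u [[T U] h]; apply: sig_eq; exact: (esym (sat_plusN_act _ _)).
Qed.

Lemma const_supp (A : set nat) (x : Ob C) :
  supported A x -> supported A (constF EM x : Ob (catM C)).
Proof.
move=> sx u uA; apply: functor_eq => /= [w|p]; first exact: sx.
by rewrite act_idm sx.
Qed.

Lemma const_fin_supp (x : Ob C) : fin_supported (constF EM x : Ob (catM C)).
Proof.
by have [A [fA sx]] := pc_tame x; exists A; split=> //; exact: const_supp.
Qed.

Definition sat_zero : Ob S := exist _ (constF EM zero) (const_fin_supp zero).

Lemma sat_nt_eq (T U : Mor S) : src T = src U -> tgt T = tgt U ->
  (forall w, (sval T : nattrans EM C) w = (sval U : nattrans EM C) w) -> T = U.
Proof.
move=> e1 e2 e3; apply: sig_eq; apply: nattrans_eq => //;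
  [exact: (eq_sval e1) | exact: (eq_sval e2)].
Qed.

Lemma src_sat_plus (T U : Mor S) (h : mdisjoint T U) :
  src (plusM sat_plus h) = plusO sat_plus (proj1 h).
Proof. by apply: sig_eq; exact: sat_plusF_eq. Qed.

Lemma tgt_sat_plus (T U : Mor S) (h : mdisjoint T U) :
  tgt (plusM sat_plus h) = plusO sat_plus (proj2 h).
Proof. by apply: sig_eq; exact: sat_plusF_eq. Qed.

Lemma sat_plusO_eq (X Y X' Y' : Ob S) (h : disjoint_supp X Y)
  (h' : disjoint_supp X' Y') :
  X = X' -> Y = Y' -> plusO sat_plus h = plusO sat_plus h'.
Proof. by move=> *; subst; rewrite (Prop_irrelevance h h'). Qed.

Lemma sat_plusO0 (X : Ob S) (h : disjoint_supp X sat_zero) :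
  plusO sat_plus h = X.
Proof.
by apply: sig_eq; apply: functor_eq => [w|p]; [exact: plusO0 | exact: plusM0].
Qed.

Lemma sat_plus0O (X : Ob S) (h : disjoint_supp sat_zero X) :
  plusO sat_plus h = X.
Proof.
by apply: sig_eq; apply: functor_eq => [w|p]; [exact: plus0O | exact: plus0M].
Qed.

Lemma sat_plusOC (X Y : Ob S) (h : disjoint_supp X Y)
  (h' : disjoint_supp Y X) : plusO sat_plus h = plusO sat_plus h'.
Proof.
by apply: sig_eq; apply: functor_eq => [w|p]; [exact: plusOC | exact: plusMC].
Qed.

Lemma sat_plusOA (X Y Z : Ob S) (xy : disjoint_supp X Y)
  (yz : disjoint_supp Y Z) (xz : disjoint_supp X Z)
  (xy_z : disjoint_supp (plusO sat_plus xy) Z)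
  (x_yz : disjoint_supp X (plusO sat_plus yz)) :
  plusO sat_plus xy_z = plusO sat_plus x_yz.
Proof.
apply: sig_eq; apply: functor_eq => [w|p].
  by apply: plusOA; exact: sat_disjoint xz w.
by apply: plusMA; exact: sat_mdisjoint xz p.
Qed.

Lemma sat_plusM0 (f : Mor S) (h : mdisjoint f (idm sat_zero)) :
  plusM sat_plus h = f.
Proof.
apply: sat_nt_eq.
- rewrite src_sat_plus -[RHS](sat_plusO0 (X := src f)).
    by case: h; rewrite src_idm.
  by move=> k; apply: sat_plusO_eq; rewrite ?src_idm.
- rewrite tgt_sat_plus -[RHS](sat_plusO0 (X := tgt f)).
    by case: h; rewrite tgt_idm.
  by move=> k; apply: sat_plusO_eq; rewrite ?tgt_idm.
- by move=> w; exact: plusM0.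
Qed.

Lemma sat_plus0M (f : Mor S) (h : mdisjoint (idm sat_zero) f) :
  plusM sat_plus h = f.
Proof.
apply: sat_nt_eq.
- rewrite src_sat_plus -[RHS](sat_plus0O (X := src f)).
    by case: h; rewrite src_idm.
  by move=> k; apply: sat_plusO_eq; rewrite ?src_idm.
- rewrite tgt_sat_plus -[RHS](sat_plus0O (X := tgt f)).
    by case: h; rewrite tgt_idm.
  by move=> k; apply: sat_plusO_eq; rewrite ?tgt_idm.
- by move=> w; exact: plus0M.
Qed.

Lemma sat_plusMC (f g : Mor S) (h : mdisjoint f g) (h' : mdisjoint g f) :
  plusM sat_plus h = plusM sat_plus h'.
Proof.
apply: sat_nt_eq.
- by rewrite !src_sat_plus; exact: sat_plusOC.
- by rewrite !tgt_sat_plus; exact: sat_plusOC.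
- by move=> w; exact: plusMC.
Qed.

Lemma sat_plusMA (f g h : Mor S) (fg : mdisjoint f g) (gh : mdisjoint g h)
  (fh : mdisjoint f h) (fg_h : mdisjoint (plusM sat_plus fg) h)
  (f_gh : mdisjoint f (plusM sat_plus gh)) :
  plusM sat_plus fg_h = plusM sat_plus f_gh.
Proof.
apply: sat_nt_eq.
- have e1 : disjoint_supp (plusO sat_plus (proj1 fg)) (src h).
    by rewrite -src_sat_plus; exact: (proj1 fg_h).
  have e2 : disjoint_supp (src f) (plusO sat_plus (proj1 gh)).
    by rewrite -src_sat_plus; exact: (proj1 f_gh).
  rewrite !src_sat_plus (sat_plusO_eq _ e1) ?src_sat_plus //.
  rewrite (sat_plusOA (proj1 fh) _ e2).
  by apply: sat_plusO_eq; rewrite ?src_sat_plus.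
- have e1 : disjoint_supp (plusO sat_plus (proj2 fg)) (tgt h).
    by rewrite -tgt_sat_plus; exact: (proj2 fg_h).
  have e2 : disjoint_supp (tgt f) (plusO sat_plus (proj2 gh)).
    by rewrite -tgt_sat_plus; exact: (proj2 f_gh).
  rewrite !tgt_sat_plus (sat_plusO_eq _ e1) ?tgt_sat_plus //.
  rewrite (sat_plusOA (proj2 fh) _ e2).
  by apply: sat_plusO_eq; rewrite ?tgt_sat_plus.
- by move=> w; apply: plusMA; exact: (sat_ntdisjoint fh w).
Qed.

Lemma sat_tame : tame S.
Proof.
by move=> [X [A [fA sX]]]; exists A; split=> //; exact/supported_sval.
Qed.

Lemma sat_act_zero u : act (u, sat_zero) = sat_zero.
Proof.
apply: sig_eq; apply: functor_eq => /= [w|p]; first exact: act_zero.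
by rewrite act_idm act_zero.
Qed.

Definition sat : parsummable :=
  Parsummable sat_tame sat_act_zero sat_plus_eqv sat_plusO0 sat_plusM0
    sat_plus0O sat_plus0M sat_plusOC sat_plusMC sat_plusOA sat_plusMA.

(* The functor s, sending x to the constant functor at x *)
Definition sat_unit : functor C sat :=
  @corestr C (funcat EM C) (constants EM C) (full (@fin_supported (catM C)))
    (fun x => const_fin_supp x)
    (fun f => conj (const_fin_supp (src f)) (const_fin_supp (tgt f))).

End SatParsum.

Record is_group_action (gT : finGroupType) (C : category)
  (A : gT -> functor C C) : Prop := IsGroupAction {
  is_group_action1 : A 1%g = idF C;
  is_group_actionM : forall g h, A (g * h)%g = compF (A g) (A h)
}.

Record Gcat (gT : finGroupType) := GCat {
  gc :> category;
  gact : gT -> functor gc gc;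
  gactP : is_group_action gact
}.
Arguments gact {gT g} _.

Section GCategories.
Variable gT : finGroupType.

Program Definition fixed_sub (C : Gcat gT) : subcategory C :=
  @Subcategory C (fun x => forall g : gT, gact g x = x)
  (fun f => forall g : gT, fM (gact g) f = f) _.
Next Obligation.
move=> C; split.
- by move=> f h g; rewrite -src_fM h.
- by move=> f h g; rewrite -tgt_fM h.
- by move=> x h g; rewrite fM_idm h.
- move=> g f e hg hf k; rewrite (fM_compm e) => [|e'].
    by rewrite hg hf.
  exact: compm_eq.
Qed.

Definition fixedC (C : Gcat gT) : category := subcat (fixed_sub C).

Program Definition EG_act (g : gT) : functor (indisc gT) (indisc gT) :=
  @Functor (indisc gT) (indisc gT) (fun h => g * h)%g
  (fun p => (g * p.1, g * p.2)%g) _.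
Next Obligation.
move=> g; split => //.
Qed.

Program Definition EG : Gcat gT :=
  @GCat gT (indisc gT) EG_act _.
Next Obligation.
split.
- by apply: functor_eq => [h|[h h']] /=; rewrite !mul1g.
- by move=> g h; apply: functor_eq => [k|[k k']] /=; rewrite !mulgA.
Qed.

Definition equivariant_functor (A C : Gcat gT) (X : functor A C) : Prop :=
  forall g : gT, compF X (gact g) = compF (gact g) X.

Program Definition equivariant_sub (A C : Gcat gT) : subcategory (funcat A C) :=
  @Subcategory (funcat A C) (@equivariant_functor A C)
  (fun T => [/\ equivariant_functor (ntsrc T), equivariant_functor (nttgt T) &
     forall (g : gT) x, T (gact g x) = fM (gact g) (T x)]) _.
Next Obligation.
move=> A C; split.
- by move=> T [].
- by move=> T [].
- move=> X hX; split=> // g x /=.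
  by rewrite fM_idm -[X _]/(compF X (gact g) x) hX.
- move=> T S e [_ h1 h2] [h3 _ h4]; split=> // g x /=.
  rewrite (fM_compm (nt_comp_ok e x)) => [|e'].
    by rewrite -h2 -h4; exact: nt_comp_ok.
  by apply: compm_eq; rewrite ?h2 ?h4.
Qed.

Definition catG (A C : Gcat gT) : category := subcat (equivariant_sub A C).

Lemma const_equivariant (C : Gcat gT) (x : Ob (fixedC C)) :
  sO (equivariant_sub EG C) (constF EG (sval x)).
Proof.
move=> g; apply: functor_eq => [h|p] /=; first by rewrite (svalP x).
by rewrite fM_idm (svalP x).
Qed.

Lemma constnt_equivariant (C : Gcat gT) (f : Mor (fixedC C)) :
  sM (equivariant_sub EG C) (constnt EG (sval f)).
Proof.
split; try exact: (const_equivariant (src f));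
  try exact: (const_equivariant (tgt f)).
by move=> g x /=; rewrite (svalP f).
Qed.

Definition fixed_to_hfixed (C : Gcat gT) : functor (fixedC C) (catG EG C) :=
  @corestr (fixedC C) (funcat EG C)
    (compF (constants EG C) (incl (fixed_sub C))) (equivariant_sub EG C)
    (@const_equivariant C) (@constnt_equivariant C).

Lemma fixed_mapO (C D : Gcat gT) (F : functor C D)
  (hF : equivariant_functor F) (x : Ob (fixedC C)) :
  sO (fixed_sub D) (F (sval x)).
Proof.
move=> g /=; rewrite -[LHS]/(compF (gact g) F (sval x)) -hF /=.
by rewrite (svalP x).
Qed.

Lemma fixed_mapM (C D : Gcat gT) (F : functor C D)
  (hF : equivariant_functor F) (f : Mor (fixedC C)) :
  sM (fixed_sub D) (fM F (sval f)).
Proof.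
move=> g /=; rewrite -[LHS]/(fM (compF (gact g) F) (sval f)) -hF /=.
by rewrite (svalP f).
Qed.

Definition fixed_map (C D : Gcat gT) (F : functor C D)
  (hF : equivariant_functor F) : functor (fixedC C) (fixedC D) :=
  @corestr (fixedC C) D (compF F (incl (fixed_sub C))) (fixed_sub D)
    (fixed_mapO hF) (fixed_mapM hF).

Record Gset := GSet {
  gs :> Type;
  gsact : gT -> gs -> gs;
  gsact1 : forall x, gsact 1%g x = x;
  gsactM : forall g h x, gsact (g * h)%g x = gsact g (gsact h x)
}.

Lemma gsact_inj (U : Gset) (g : gT) : injective (@gsact U g).
Proof.
apply: (can_inj (g := gsact (g^-1)%g)) => x.
by rewrite -gsactM mulVg gsact1.
Qed.

Definition omegaG : Gset.
Proof.
apply: (@GSet {ffun gT -> nat}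
  (fun g f => [ffun h => f (g^-1 * h)%g])).
- by move=> f; apply/ffunP => h; rewrite ffunE invg1 mul1g.
- by move=> g h f; apply/ffunP => k; rewrite !ffunE invMg mulgA.
Defined.

End GCategories.

Definition countably_infinite (U : Type) : Prop := [set: U] #= [set: nat].

(* A choice of bijections kappa_U : nat -> U (with their inverses), one for
   every countably infinite U, such that kappa_nat is the identity. *)
Record bijections := Bijections {
  kap : forall U : Type, countably_infinite U -> nat -> U;
  kapV : forall U : Type, countably_infinite U -> U -> nat;
  kapK : forall U (hU : countably_infinite U), cancel (kap hU) (kapV hU);
  kapVK : forall U (hU : countably_infinite U), cancel (kapV hU) (kap hU);
  kap_nat : forall (h : countably_infinite nat) n, kap h n = n
}.

Section Evaluation.
Variable K : bijections.

Definition transfer (U V : Type) (hU : countably_infinite U)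
  (hV : countably_infinite V) (j : U -> V) (hj : injective j) : inj :=
  Inj (inj_comp (can_inj (kapVK K hV)) (inj_comp hj (can_inj (kapK K hU)))).

Program Definition act_functor (C : Mcat) (u : inj) : functor C C :=
  @Functor C C (@uO C u) (@uM C u) _.
Next Obligation.
move=> C u; split.
- exact: src_act.
- exact: tgt_act.
- exact: act_idm.
- by move=> g f e e'; exact: act_compm.
Qed.

Variables (gT : finGroupType) (U : Gset gT) (hU : countably_infinite U).

(* The category C[U] with its action of the group *)
Program Definition eval (C : Mcat) : Gcat gT :=
  @GCat gT C
  (fun g => act_functor C (transfer hU hU (@gsact_inj gT U g))) _.
Next Obligation.
move=> C; split.
- have -> : transfer hU hU (@gsact_inj gT U 1%g) = inj1.
    by apply: inj_eq_ext => n /=; rewrite gsact1 kapK.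
  by apply: functor_eq => x; [exact: act1O | exact: act1M].
- move=> g h.
  have -> : transfer hU hU (@gsact_inj gT U (g * h)%g) =
      injM (transfer hU hU (@gsact_inj gT U g))
           (transfer hU hU (@gsact_inj gT U h)).
    by apply: inj_eq_ext => n /=; rewrite gsactM kapVK.
  by apply: functor_eq => x /=; [rewrite /uO actMO | rewrite /uM actMM].
Qed.

Lemma eval_map_eqv (C D : Mcat) (F : functor C D) (hF : equivariant F)
  (g : gT) :
  compF F (gact g : functor (eval C) (eval C)) =
  compF (gact g : functor (eval D) (eval D)) F.
Proof.
by apply: functor_eq => x; [exact: (eqvO hF) | exact: (eqvM hF)].
Qed.

End Evaluation.

Lemma ffun_nat_infinite (T : finType) (x : T) :
  ~ finite_set [set: {ffun T -> nat}].
Proof.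
move=> fin; apply: infinite_nat.
have -> : [set: nat] =
    (fun f : {ffun T -> nat} => f x) @` [set: {ffun T -> nat}].
  by apply/seteqP; split=> // n _; exists [ffun=> n]; rewrite ?ffunE.
exact: finite_image fin.
Qed.

Lemma omegaG_countable (gT : finGroupType) : countably_infinite (omegaG gT).
Proof.
apply: eq_card_nat; first exact: (@countableP {ffun gT -> nat}).
exact: (@ffun_nat_infinite gT 1%g).
Qed.

Section Saturated.
Variable K : bijections.

Definition FG (gT : finGroupType) (C : Mcat) : category :=
  fixedC (eval K (omegaG_countable gT) C).

Definition FhG (gT : finGroupType) (C : Mcat) : category :=
  catG (EG gT) (eval K (omegaG_countable gT) C).

Definition kappa (gT : finGroupType) (C : Mcat) :
  functor (FG gT C) (FhG gT C) :=
  fixed_to_hfixed (eval K (omegaG_countable gT) C).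

Definition FG_map (gT : finGroupType) (C D : Mcat) (F : functor C D)
  (hF : equivariant F) : functor (FG gT C) (FG gT D) :=
  @fixed_map gT (eval K (omegaG_countable gT) C)
    (eval K (omegaG_countable gT) D) F
    (eval_map_eqv K (omegaG_countable gT) hF).

Definition saturated (C : Mcat) : Prop :=
  forall gT : finGroupType, is_equivalence (kappa gT C).

Definition global_equivalence (C D : Mcat) (F : functor C D)
  (hF : equivariant F) : Prop :=
  forall gT : finGroupType, weak_equivalence (FG_map gT hF).

End Saturated.

(* Main.v *)
(* For every category with G-action the comparison from fixed points to homotopy
   fixed points is fully faithful, so that saturation says that every equivariant
   functor Z from EG is equivariantly isomorphic to a constant functor at a fixed
   object. The functor s is an equivalence, with inverse the evaluation at the
   identity of M; hence every homotopy fixed point of C^sat comes from a homotopy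
   fixed point Z of C. A fixed object of C^sat isomorphic to s Z is the composite
   of Z with the functor EM -> EG given by any map r : M -> G equivariant for
   precomposition. It is finitely supported if r(w) depends only on the
   restriction of w to a finite set: choose a free G-orbit of points p_g in
   omega^G and let r(w) be the g for which w(p_g) is minimal. For morphisms one
   also needs that u_* f = f when u is the identity on a finite support of both
   ends of f. For (iii), saturation of C makes F^G s an equivalence, and the
   natural isomorphisms witnessing an equivalence give simplicial homotopies on
   nerves. *)

From mathcomp Require Import all_boot all_fingroup.
From mathcomp Require Import boolp classical_sets functions cardinality.
Require Import Defs.

Set Implicit Arguments.
Unset Strict Implicit.
Unset Printing Implicit Defensive.

Local Open Scope classical_set_scope.

(** * Composition as a total operation, and chosen inverses *)

Section Composition.
Variable C : category.
Implicit Types f g h : Mor C.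

(* Junk value [g] when [g] and [f] are not composable. *)
Definition comp g f : Mor C :=
  if pselect (src g = tgt f) is left e then compm g f e else g.

Lemma compE g f (e : src g = tgt f) : compm g f e = comp g f.
Proof. by rewrite /comp; case: pselect => // e'; exact: compm_eq. Qed.

Lemma src_comp g f : src g = tgt f -> src (comp g f) = src f.
Proof. by move=> e; rewrite -compE src_compm. Qed.

Lemma tgt_comp g f : src g = tgt f -> tgt (comp g f) = tgt g.
Proof. by move=> e; rewrite -compE tgt_compm. Qed.

Lemma comp1l x f : tgt f = x -> comp (idm x) f = f.
Proof.
move=> e; have e' : src (idm x) = tgt f by rewrite src_idm.
by rewrite -(compE e') compm1l.
Qed.

Lemma comp1r x g : src g = x -> comp g (idm x) = g.
Proof.
move=> e; have e' : src g = tgt (idm x) by rewrite tgt_idm.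
by rewrite -(compE e') compm1r.
Qed.

Lemma compA h g f : src h = tgt g -> src g = tgt f ->
  comp (comp h g) f = comp h (comp g f).
Proof.
move=> hg gf; have hg_f : src (comp h g) = tgt f by rewrite src_comp.
have h_gf : src h = tgt (comp g f) by rewrite tgt_comp.
rewrite -(compE hg_f) -(compE h_gf).
have a : src (compm h g hg) = tgt f by rewrite src_compm.
have b : src h = tgt (compm g f gf) by rewrite tgt_compm.
transitivity (compm _ _ a); first by apply: compm_eq => //; rewrite compE.
by rewrite (compmA hg gf a b); apply: compm_eq => //; rewrite compE.
Qed.

(** The existential stands outside the hypothesis [is_iso f], so that [invm] can be chosen as a
    total function; for a non-isomorphism any morphism is a witness. *)
Lemma invm_ex f : exists g, is_iso f ->
  [/\ src g = tgt f, tgt g = src f, comp g f = idm (src f) &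
    comp f g = idm (tgt f)].
Proof.
have [[g [gf [fg [e1 e2]]]]|] := pselect (is_iso f); last by exists f.
by exists g; split=> //; rewrite -compE.
Qed.

Definition invm f : Mor C := sval (cid (invm_ex f)).

Lemma invmP f : is_iso f -> [/\ src (invm f) = tgt f, tgt (invm f) = src f,
  comp (invm f) f = idm (src f) & comp f (invm f) = idm (tgt f)].
Proof. exact: (svalP (cid (invm_ex f))). Qed.

Lemma isoP f g : src g = tgt f -> tgt g = src f ->
  comp g f = idm (src f) -> comp f g = idm (tgt f) -> is_iso f.
Proof.
move=> e1 e2 e3 e4; exists g, e1, (esym e2).
by rewrite !compE.
Qed.

End Composition.

Lemma fM_comp (C D : category) (F : functor C D) (g f : Mor C) :
  src g = tgt f -> fM F (comp g f) = comp (fM F g) (fM F f).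
Proof.
move=> e; have e' : src (fM F g) = tgt (fM F f) by rewrite src_fM tgt_fM e.
by rewrite -(compE e') -(compE e) (fM_compm e e').
Qed.

Lemma ntc_comp (C D : category) (T : nattrans C D) (f : Mor C) :
  comp (T (tgt f)) (fM (ntsrc T) f) = comp (fM (nttgt T) f) (T (src f)).
Proof.
have e : src (T (tgt f)) = tgt (fM (ntsrc T) f) by rewrite src_ntc tgt_fM.
have e' : src (fM (nttgt T) f) = tgt (T (src f)) by rewrite src_fM tgt_ntc.
by rewrite -(compE e) -(compE e') ntc_nat.
Qed.

(** Computes sources and targets of composites; the composability conditions that arise on the way
    are discharged recursively. *)
Ltac ends := solve [
  repeat first
    [ done | congruence
    | rewrite src_idm | rewrite tgt_idm
    | rewrite src_comp; [|by ends] | rewrite tgt_comp; [|by ends]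
    | rewrite src_fM | rewrite tgt_fM | rewrite src_ntc | rewrite tgt_ntc ] ].

(** * Cancellation and preservation of isomorphisms *)

Section Isomorphisms.
Variable C : category.
Implicit Types f g h : Mor C.

Lemma src_invm f : is_iso f -> src (invm f) = tgt f.
Proof. by case/invmP. Qed.

Lemma tgt_invm f : is_iso f -> tgt (invm f) = src f.
Proof. by case/invmP. Qed.

Lemma compKV f g : is_iso f -> src f = tgt g ->
  comp (invm f) (comp f g) = g.
Proof. by case/invmP=> e1 e2 e3 e4 e; rewrite -compA // e3 comp1l. Qed.

Lemma compVK f g : is_iso f -> tgt f = tgt g ->
  comp f (comp (invm f) g) = g.
Proof. by case/invmP=> e1 e2 e3 e4 e; rewrite -compA ?e1 // e4 comp1l. Qed.

Lemma comp_injl f g g' : is_iso f -> src f = tgt g -> src f = tgt g' ->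
  comp f g = comp f g' -> g = g'.
Proof. by move=> i e e' E; rewrite -(compKV i e) E compKV. Qed.

Lemma iso_comp g f : src g = tgt f -> is_iso g -> is_iso f ->
  is_iso (comp g f).
Proof.
move=> e ig iF; have [g1 g2 g3 g4] := invmP ig; have [f1 f2 f3 f4] := invmP iF.
apply: (@isoP _ _ (comp (invm f) (invm g))); try ends.
- rewrite compA; try ends. rewrite (compKV ig) //; try ends.
- rewrite compA; try ends. rewrite (compVK iF); try ends.
Qed.

End Isomorphisms.

Lemma iso_fM (C D : category) (F : functor C D) (f : Mor C) :
  is_iso f -> is_iso (fM F f).
Proof.
case/invmP=> e1 e2 e3 e4; apply: (@isoP _ _ (fM F (invm f))); try ends.
- by rewrite -fM_comp // e3 fM_idm src_fM.
- by rewrite -fM_comp // e4 fM_idm tgt_fM.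
Qed.

(** * Fully faithful functors and equivalences *)

Section FullyFaithful.

(** Since all morphisms live in one type, bijectivity on hom-sets becomes unique lifting with
    prescribed ends. The ends have to be prescribed because [F] may identify objects. *)
Definition fully_faithful (C D : category) (F : functor C D) : Prop :=
  forall x y (h : Mor D), src h = F x -> tgt h = F y ->
  exists f, [/\ src f = x, tgt f = y, fM F f = h &
    forall f', src f' = x -> tgt f' = y -> fM F f' = h -> f' = f].

Definition essentially_surjective (C D : category) (F : functor C D) : Prop :=
  forall y, exists x h, [/\ is_iso h, src h = F x & tgt h = y].

Variables C D : category.
Variable F : functor C D.

Lemma ff_inj : fully_faithful F -> forall f f', src f = src f' ->
  tgt f = tgt f' -> fM F f = fM F f' -> f = f'.
Proof.
move=> ff f f' es et e; have es' : src (fM F f) = F (src f) by ends.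
have et' : tgt (fM F f) = F (tgt f) by ends.
have [f0 [_ _ _ u]] := ff _ _ _ es' et'.
by rewrite (u f) // (u f').
Qed.

Lemma ff_full : fully_faithful F -> forall x y h, src h = F x -> tgt h = F y ->
  exists f, [/\ src f = x, tgt f = y & fM F f = h].
Proof.
by move=> ff x y h es et; have [f [? ? ? _]] := ff _ _ _ es et; exists f.
Qed.

Lemma ffI :
  (forall f f', src f = src f' -> tgt f = tgt f' -> fM F f = fM F f' ->
    f = f') ->
  (forall x y h, src h = F x -> tgt h = F y ->
    exists f, [/\ src f = x, tgt f = y & fM F f = h]) ->
  fully_faithful F.
Proof.
move=> inj full x y h es et; have [f [e1 e2 e3]] := full _ _ _ es et.
by exists f; split=> // f' e1' e2' e3'; apply: inj; congruence.
Qed.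

Lemma ff_iso : fully_faithful F -> forall f, is_iso (fM F f) -> is_iso f.
Proof.
move=> ff f /invmP[e1 e2 e3 e4].
have s1 : src (invm (fM F f)) = F (tgt f) by rewrite e1; ends.
have s2 : tgt (invm (fM F f)) = F (src f) by rewrite e2; ends.
have [g [g1 g2 g3]] := ff_full ff s1 s2.
apply: (@isoP _ _ g) => //.
- apply: (ff_inj ff); try ends.
  by rewrite fM_comp // g3 e3 fM_idm src_fM.
- apply: (ff_inj ff); try ends.
  by rewrite fM_comp // g3 e4 fM_idm tgt_fM.
Qed.

(** Transport of structure: conjugated by the isomorphisms [phi], the morphisms [fM Y p] run between
    objects in the image of [F] and lift along [F]; uniqueness of lifts gives functoriality.
    Quasi-inverses and lifts of homotopy fixed points both arise in this way. *)
Lemma ff_lift (A : category) (Y : functor A D) (ZO : Ob A -> Ob C)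
  (phi : Ob A -> Mor D) : fully_faithful F ->
  (forall a, [/\ is_iso (phi a), src (phi a) = F (ZO a) & tgt (phi a) = Y a]) ->
  exists (Z : functor A C) (T : nattrans A D), [/\ forall a, Z a = ZO a,
    ntsrc T = compF F Z, nttgt T = Y & forall a, T a = phi a].
Proof.
move=> ff phiP.
have liftP (p : Mor A) : exists f : Mor C, [/\ src f = ZO (src p),
    tgt f = ZO (tgt p) &
    comp (phi (tgt p)) (fM F f) = comp (fM Y p) (phi (src p))].
  have [i1 s1 t1] := phiP (src p); have [i2 s2 t2] := phiP (tgt p).
  have [f1 f2 f3 f4] := invmP i2.
  pose h := comp (invm (phi (tgt p))) (comp (fM Y p) (phi (src p))).
  have a1 : src h = F (ZO (src p)) by rewrite /h; ends.
  have a2 : tgt h = F (ZO (tgt p)) by rewrite /h; ends.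
  have [f [? ? e]] := ff_full ff a1 a2.
  by exists f; split=> //; rewrite e compVK //; ends.
have [ZM ZMP] := choice liftP.
have Zuniq (f f' : Mor C) a : tgt f = ZO a -> tgt f' = ZO a ->
    src f = src f' ->
    comp (phi a) (fM F f) = comp (phi a) (fM F f') -> f = f'.
  move=> t t' s e; apply: (ff_inj ff); try congruence.
  have [i1 s1 t1] := phiP a.
  by apply: comp_injl i1 _ _ e; ends.
have Zfun : is_functor ZO ZM.
  split.
  - by move=> p; case: (ZMP p).
  - by move=> p; case: (ZMP p).
  - move=> a; have [e1 e2 e3] := ZMP (idm a).
    rewrite !src_idm !tgt_idm fM_idm in e1 e2 e3.
    have [i1 s1 t1] := phiP a.
    apply: (Zuniq _ _ a); try ends.
    by rewrite e3 fM_idm comp1l // comp1r.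
  - move=> q p e e'; rewrite !compE.
    have [s1 t1 c1] := ZMP q; have [s2 t2 c2] := ZMP p.
    have [s3 t3 c3] := ZMP (comp q p).
    rewrite src_comp // in s3 c3; rewrite tgt_comp // in t3 c3.
    have [i4 s4 t4] := phiP (tgt q).
    have [i5 s5 t5] := phiP (src q).
    have [i6 s6 t6] := phiP (src p).
    apply: (Zuniq _ _ (tgt q)); try ends.
    rewrite c3 !fM_comp // -compA; try ends.
    rewrite c1 compA; try ends.
    by rewrite compA; ends.
have nat : is_natural (compF F (Functor Zfun)) Y phi.
  split.
  - by move=> a; case: (phiP a).
  - by move=> a; case: (phiP a).
  - by move=> p e e'; rewrite !compE /=; case: (ZMP p).
by exists (Functor Zfun), (NatTrans nat).
Qed.

Lemma ff_es_equivalence :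
  fully_faithful F -> essentially_surjective F -> is_equivalence F.
Proof.
move=> ff es; have /choice[G0 /choice[eps epsP]] := es.
have [G [T [G0E T1 T2 TE]]] := ff_lift (Y := idF D) ff epsP.
exists G; split; last first.
  by exists T; split=> // y; rewrite TE; case: (epsP y).
(* The unit at [x] is the lift of the counit at [F x], so its naturality and invertibility can be
   checked after applying [F]. *)
have etaP (x : Ob C) : exists f : Mor C,
    [/\ src f = G (F x), tgt f = x & fM F f = T (F x)].
  by apply: (ff_full ff); rewrite ?src_ntc ?T1 ?tgt_ntc ?T2.
have [eta etaQ] := choice etaP.
have nat : is_natural (compF G F) (idF C) eta.
  split.
  - by move=> x; case: (etaQ x).
  - by move=> x; case: (etaQ x).
  - move=> f e e'; rewrite !compE /=.
    have [s1 t1 f1] := etaQ (tgt f); have [s2 t2 f2] := etaQ (src f).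
    have n := ntc_comp T (fM F f); rewrite T1 T2 /= src_fM tgt_fM in n.
    apply: (ff_inj ff); [ends|ends|].
    by rewrite !fM_comp ?f1 ?f2 //; ends.
exists (NatTrans nat); split=> // x; apply: (ff_iso ff) => /=.
by have [_ _ ->] := etaQ x; rewrite TE; have [] := epsP (F x).
Qed.

End FullyFaithful.

Lemma equivalence_es (C D : category) (F : functor C D) :
  is_equivalence F -> essentially_surjective F.
Proof.
move=> [G [_ [T [e1 e2 iT]]]] y; exists (G y), (T y).
by split=> //; rewrite ?src_ntc ?tgt_ntc ?e1 ?e2.
Qed.

(** * Natural transformations as homotopies of nerves *)

Lemma pair_functor (A C D : category) (F : functor A C) (G : functor A D) :
  @is_functor A (prodC C D) (fun x => (F x, G x)) (fun f => (fM F f, fM G f)).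
Proof.
split.
- by move=> f; rewrite /= !src_fM.
- by move=> f; rewrite /= !tgt_fM.
- by move=> x; rewrite /= !fM_idm.
- by move=> g f e e'; rewrite /=; congr pair; exact: fM_compm.
Qed.

Definition pairF (A C D : category) (F : functor A C) (G : functor A D) :
  functor A (prodC C D) := Functor (pair_functor F G).

Section Cylinder.
Variables C D : category.
Variable S : nattrans C D.

Definition cylO (p : Ob (prodC C (ordcat 1))) : Ob D :=
  if sval p.2 == ord0 then ntsrc S p.1 else nttgt S p.1.

(** The second component of [p] is a pair (target, source) in [1]. A target equal to 0 forces the
    source to be 0; the middle case is the jump from 0 to 1, where the component of [S] enters. *)
Definition cylM (p : Mor (prodC C (ordcat 1))) : Mor D :=
  if (sval p.2).1 == ord0 then fM (ntsrc S) p.1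
  else if (sval p.2).2 == ord0 then comp (fM (nttgt S) p.1) (S (src p.1))
  else fM (nttgt S) p.1.

Lemma cyl_functor : is_functor cylO cylM.
Proof.
have le0 (i : 'I_2) : (i <= @ord0 1)%N -> i = ord0.
  by rewrite leqn0 => /eqP i0; exact: val_inj.
split.
- move=> [f [[j i] /= ij]]; rewrite /cylM /cylO /=.
  case: eqP => [j0|_]; last by case: eqP => _; ends.
  by rewrite j0 in ij; rewrite (le0 _ ij) eqxx; ends.
- move=> [f [[j i] /= ij]]; rewrite /cylM /cylO /=.
  by case: eqP => // _; [ends | case: eqP => _; ends].
- move=> [x [i []]]; rewrite /cylM /cylO /=.
  by case: eqP => _; rewrite fM_idm.
- move=> [g [[k j] /= jk]] [f [[j' i] /= ij]] e e'.
  have ej : j = j' := congr1 sval (eq_snd e).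
  have ec : src g = tgt f := eq_fst e.
  subst j'; rewrite [RHS]compE /cylM /= !compE.
  case: eqP => [k0|_].
    by rewrite (le0 j) ?eqxx ?fM_comp // -k0.
  (* If the jump from 0 to 1 happens in [g], the component of [S] sits between the two factors and
     naturality moves it past [f]. In the other possible cases functoriality suffices. *)
  case: eqP => [i0|ni]; case: eqP => [j0|nj].
  - rewrite fM_comp // src_comp // !compA; try ends.
    by rewrite ec ntc_comp.
  - by rewrite fM_comp // src_comp // compA //; ends.
  - by case: ni; apply: le0; rewrite -j0.
  - by rewrite fM_comp.
Qed.

Definition cyl : functor (prodC C (ordcat 1)) D := Functor cyl_functor.

(** A simplex of the prism over the nerve of [C] is a pair of functors from [n] to [C] and to [1];
    paired and composed with [cyl] they give a simplex of the nerve of [D]. The ends [f0] and [f1]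
    are described simplex by simplex, so that composites agreeing only extensionally are covered. *)
Lemma nattrans_edge (K : sset) (g : ssmap (nerve D) K)
  (f0 f1 : ssmap (nerve C) K) :
  (forall n (x : nerve C n), f0 n x = g n (compF (ntsrc S) x)) ->
  (forall n (x : nerve C n), f1 n x = g n (compF (nttgt S) x)) ->
  edge_homotopy f0 f1.
Proof.
move=> e0 e1.
pose h n (p : prodS (nerve C) (simplex 1) n) : K n :=
  g n (compF cyl (pairF p.1 (ordF p.2)) : functor (ordcat n) D).
have hnat m n (a : monotone m n) p : h m (smap a p) = smap a (h n p).
  by rewrite /h -ssm_nat; congr (g m _); exact: functor_eq.
exists (SSMap hnat) => n x; rewrite e0 e1 /= /h.
by split; congr (g n _); exact: functor_eq.
Qed.

End Cylinder.

Lemma homotopic_trans (X K : sset) (f g h : ssmap X K) :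
  homotopic f g -> homotopic g h -> homotopic f h.
Proof.
move=> fg; elim: fg h => // {f g} f g k e _ IH h /IH.
- exact: homotopic_edge.
- exact: homotopic_edge_inv.
Qed.

Lemma homotopic_compS (X Y K : sset) (f g : ssmap Y K) (k : ssmap X Y) :
  homotopic f g -> homotopic (compS f k) (compS g k).
Proof.
have edge (u v : ssmap Y K) : edge_homotopy u v ->
    edge_homotopy (compS u k) (compS v k).
  move=> [h hP].
  pose hk n (p : prodS X (simplex 1) n) : K n := h n (k n p.1, p.2).
  have hnat m n (a : monotone m n) p : hk m (smap a p) = smap a (hk n p).
    by rewrite /hk -ssm_nat /= ssm_nat.
  by exists (SSMap hnat) => n x; exact: hP.
elim=> {f g} [f|f g h /edge e _|f g h /edge e _].
- exact: homotopic_refl.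
- exact: homotopic_edge.
- exact: homotopic_edge_inv.
Qed.

(** On homotopy classes, restriction along the nerve of a quasi-inverse [G] is inverse to
    restriction along the nerve of [F]. *)
Lemma equivalence_weak (C D : category) (F : functor C D) :
  is_equivalence F -> weak_equivalence F.
Proof.
move=> [G [[S [S1 S2 _]] [T [T1 T2 _]]]] K _; split=> [g|h h' hh'].
  exists (compS g (nerve_map G)).
  apply: homotopic_edge (homotopic_refl _).
  apply: (@nattrans_edge _ _ S K g) => n x; rewrite ?S1 ?S2 /=;
    by congr (g n _); exact: functor_eq.
have edge (k : ssmap (nerve D) K) :
    edge_homotopy (compS (compS k (nerve_map F)) (nerve_map G)) k.
  apply: (@nattrans_edge _ _ T K k) => n x; rewrite ?T1 ?T2 /=;
    by congr (k n _); exact: functor_eq.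
(* The chain is h ~ h F G ~ h' F G ~ h'. *)
apply: homotopic_edge_inv (edge h) _.
apply: homotopic_trans (homotopic_compS _ hh') _.
exact: homotopic_edge (edge h') (homotopic_refl _).
Qed.

(** * The action on morphisms between finitely supported objects *)

Section Support.
Variable C : Mcat.
Implicit Types (x y : Ob C) (f : Mor C) (A : set nat).

Lemma act_comp (w v u : inj) (g f : Mor C) : src g = tgt f ->
  fM act ((w, u), comp g f) = comp (fM act ((w, v), g)) (fM act ((v, u), f)).
Proof.
move=> e; have e' : src (fM act ((w, v), g)) = tgt (fM act ((v, u), f)).
  by rewrite src_act tgt_act e.
by rewrite -(compE e') -(compE e) (act_compm e e').
Qed.

(** A morphism is recovered from its image by composing with [[u, 1]] at its source and [[1, v]] at
    its target, which depend only on the ends. *)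
Lemma act_inj (v u : inj) f f' : src f = src f' -> tgt f = tgt f' ->
  fM act ((v, u), f) = fM act ((v, u), f') -> f = f'.
Proof.
move=> es et e.
have K (h : Mor C) : h = comp (fM act ((inj1, v), idm (tgt h)))
    (comp (fM act ((v, u), h)) (fM act ((u, inj1), idm (src h)))).
  rewrite -!act_comp ?comp1r ?comp1l ?tgt_idm ?src_idm //.
  by rewrite act1M.
by rewrite (K f) (K f') es et e.
Qed.

(* Take injections [t] and [d] fixing [A] whose images meet only in [A], and let
   [p] be [t u t^-1] on the image of [t] and the identity elsewhere. As
   [p d = d] and [d] fixes [x], [p, 1]^x is an identity; as [p t = t u] and [t]
   fixes [x], so is [t_* [u, 1]^x]. *)
Lemma bracket_supp A x (u : inj) : finite_set A -> supported A x ->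
  (forall n, A n -> u n = n) -> bracket u inj1 x = idm x.
Proof.
move=> fA sx uA; case/finite_seqP: (fA) => s As.
have us n : n \in s -> u n = n by move=> ns; apply: uA; rewrite As.
pose N := (\max_(n <- s) n).+1.
have Ns n : n \in s -> n < N by move=> ns; rewrite ltnS leq_bigmax_seq.
(* Outside [s] the values are at least [N], even for [false] and odd for [true]; hence the images of
   [t] and [d] meet only in [s]. *)
pose t0 (b : bool) n := if n \in s then n else b + (n + N).*2.
have Nt (b : bool) n : N <= b + (n + N).*2.
  apply: leq_trans (leq_addl _ _); rewrite -addnn.
  by apply: leq_trans (leq_addl _ _); exact: leq_addl.
have NsN n b m : n \in s -> n <> nat_of_bool b + (m + N).*2.
  by move=> /Ns ns e; rewrite e ltnNge Nt in ns.
have t0i b : injective (t0 b).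
  move=> m n; rewrite /t0; case: ifP => ms; case: ifP => ns //.
  - by move=> /(NsN _ _ _ ms).
  - by move=> /esym/(NsN _ _ _ ns).
  - by move=> /addnI/double_inj/addIn.
pose t := Inj (t0i false); pose d := Inj (t0i true).
have tA n : A n -> t n = n by rewrite As /= /t0 => ->.
have dA n : A n -> d n = n by rewrite As /= /t0 => ->.
pose p0 n := if pselect (exists m, t m = n) is left e
  then t (u (sval (cid e))) else n.
have p0t m : p0 (t m) = t (u m).
  rewrite /p0; case: pselect => [e|[]]; last by exists m.
  by case: cid => m' /= /(t0i false) ->.
have p0n n : ~ (exists m, t m = n) -> p0 n = n.
  by rewrite /p0; case: pselect.
have p0i : injective p0.
  move=> m n.
  have [[m' <-]|hm] := pselect (exists k, t k = m);
    have [[n' <-]|hn] := pselect (exists k, t k = n).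
  - by rewrite !p0t => /(t0i false)/inj_injective ->.
  - by rewrite p0t (p0n n) // => e; case: hn; exists (u m').
  - by rewrite p0t (p0n m) // => e; case: hm; exists (u n').
  - by rewrite !p0n.
pose p := Inj p0i.
have pt : injM p t = injM t u by apply: inj_eq_ext => n; exact: p0t.
have pd : injM p d = d.
  apply: inj_eq_ext => n; rewrite [LHS]/= {1}/t0; case: ifP => ns.
    have tn : t n = n by apply: tA; rewrite As.
    by rewrite -{1}tn p0t us // tn [RHS]/= /t0 ns.
  rewrite p0n; first by rewrite [RHS]/= /t0 ns.
  move=> [m]; rewrite /= /t0; case: ifP => ms.
    exact: (NsN _ true).
  by move/(congr1 odd); rewrite !oddD !odd_double.
have tx : act (t, x) = x by exact: sx.
have dx : act (d, x) = x by exact: sx.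
have Bp : bracket p inj1 x = idm x.
  by rewrite /bracket -{1}dx -act_idm actMM inj1M pd act_idm dx.
apply: (@act_inj t t); rewrite ?src_act ?tgt_act ?src_idm ?tgt_idm ?act1O //.
  exact: sx.
have -> : fM act ((t, t), bracket u inj1 x) =
    fM act ((p, inj1), fM act ((t, t), idm x)).
  by rewrite !actMM injM1 inj1M pt.
by rewrite act_idm tx; exact: Bp.
Qed.

(** Both [f] and [uM u f] arise from the action of [(inj1, u)] on [f] by composing with a bracket
    [[u, 1]], at the source and at the target respectively, and these brackets are identities by
    [bracket_supp]. *)
Lemma uM_supp A f (u : inj) : finite_set A -> supported A (src f) ->
  supported A (tgt f) -> (forall n, A n -> u n = n) -> uM u f = f.
Proof.
move=> fA ss st uA.
have bs := bracket_supp fA ss uA; have bt := bracket_supp fA st uA.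
have e : comp (fM act ((inj1, u), f)) (bracket u inj1 (src f)) = f.
  by rewrite /bracket -act_comp ?tgt_idm // comp1r // act1M.
have e' : comp (bracket u inj1 (tgt f)) (fM act ((inj1, u), f)) = uM u f.
  by rewrite /bracket -act_comp ?src_idm // comp1l.
rewrite bs comp1r in e; last by rewrite src_act ss.
by rewrite bt comp1l ?tgt_act ?act1O // in e'; rewrite -e' e.
Qed.

End Support.

(** * Isomorphisms in functor categories and subcategories *)

Lemma invm_uniq (C : category) (f g : Mor C) : is_iso f -> src f = tgt g ->
  comp f g = idm (tgt f) -> g = invm f.
Proof.
move=> i e; have [e1 e2 e3 e4] := invmP i => E.
by apply: (comp_injl i); rewrite ?e4.
Qed.

Lemma invm_fM (C D : category) (F : functor C D) (f : Mor C) : is_iso f ->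
  invm (fM F f) = fM F (invm f).
Proof.
move=> i; have [e1 e2 e3 e4] := invmP i.
symmetry; apply: invm_uniq; [exact: iso_fM | by rewrite src_fM tgt_fM e2 |].
by rewrite -fM_comp // e4 fM_idm tgt_fM.
Qed.

Section NaturalIsomorphisms.
Variables A C : category.
Implicit Types S T : Mor (funcat A C).

Lemma funcat_comp S T x : src S = tgt T ->
  (comp S T : nattrans A C) x =
  comp ((S : nattrans A C) x) ((T : nattrans A C) x).
Proof. by move=> e; rewrite -(compE e) /= compE. Qed.

Lemma invnt_natural (T : nattrans A C) : (forall x, is_iso (T x)) ->
  is_natural (nttgt T) (ntsrc T) (fun x => invm (T x)).
Proof.
move=> i; split.
- by move=> x; rewrite src_invm // tgt_ntc.
- by move=> x; rewrite tgt_invm // src_ntc.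
- move=> f e e'; rewrite !compE.
  have [s1 t1 c1 d1] := invmP (i (src f)).
  have [s2 t2 c2 d2] := invmP (i (tgt f)).
  apply: (comp_injl (i (tgt f))); [ends|ends|].
  rewrite compVK //; last by ends.
  rewrite -compA; [|ends|ends].
  by rewrite ntc_comp compA ?d1 ?comp1r //; ends.
Qed.

Lemma funcat_iso T : (forall x, is_iso ((T : nattrans A C) x)) -> is_iso T.
Proof.
move=> i; pose T' := NatTrans (invnt_natural i) : Mor (funcat A C).
apply: (@isoP _ _ T') => //; apply: nattrans_eq.
- by rewrite -[LHS]/(src (comp T' T)) src_comp.
- by rewrite -[LHS]/(tgt (comp T' T)) tgt_comp.
- by move=> x; rewrite funcat_comp //=; have [_ _ -> _] := invmP (i x); ends.
- by rewrite -[LHS]/(src (comp T T')) src_comp.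
- by rewrite -[LHS]/(tgt (comp T T')) tgt_comp.
- by move=> x; rewrite funcat_comp //=; have [_ _ _ ->] := invmP (i x); ends.
Qed.

Lemma iso_component T x : is_iso T -> is_iso ((T : nattrans A C) x).
Proof.
move=> /invmP[e1 e2 e3 e4].
have E S S' : S = S' -> (S : nattrans A C) x = (S' : nattrans A C) x.
  by move=> ->.
apply: (@isoP _ _ ((invm T : nattrans A C) x)).
- by rewrite src_ntc tgt_ntc; exact: (congr1 (fun X : functor A C => X x) e1).
- by rewrite src_ntc tgt_ntc; exact: (congr1 (fun X : functor A C => X x) e2).
- by rewrite -funcat_comp // (E _ _ e3) src_ntc.
- by rewrite -funcat_comp // (E _ _ e4) tgt_ntc.
Qed.

End NaturalIsomorphisms.

Lemma invm_component (A C : category) (T : Mor (funcat A C)) x : is_iso T ->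
  (invm T : nattrans A C) x = invm ((T : nattrans A C) x).
Proof.
move=> i; have [e1 e2 e3 e4] := invmP i.
apply: invm_uniq; first exact: iso_component.
- rewrite src_ntc tgt_ntc.
  exact: (esym (congr1 (fun X : functor A C => X x) e2)).
- by rewrite -funcat_comp // e4 /= tgt_ntc.
Qed.

Lemma subcat_iso (C : category) (S : subcategory C) (f : Mor (subcat S)) :
  is_iso (sval f) -> sM S (invm (sval f)) -> is_iso f.
Proof.
move=> i Si; have [e1 e2 e3 e4] := invmP i.
pose g : Mor (subcat S) := exist _ (invm (sval f)) Si.
have gf : src g = tgt f by apply: sig_eq.
have fg : src f = tgt g by apply: sig_eq.
by apply: (@isoP _ _ g) => //; apply: sig_eq;
  rewrite -[LHS]/(fM (incl S) _) fM_comp.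
Qed.

Lemma full_iso (C : category) (P : Ob C -> Prop) (f : Mor (subcat (full P))) :
  is_iso (sval f) -> is_iso f.
Proof.
move=> i; apply: subcat_iso => //; have [h1 h2] := svalP f.
by split; rewrite ?src_invm ?tgt_invm.
Qed.

(** * Fixed points and homotopy fixed points *)

Section EquivariantIsomorphisms.
Variable gT : finGroupType.
Implicit Types A C D : Gcat gT.

(** For equivariant [X] and [Y] this is isomorphism in [catG A C]; bare functors are used so as not
    to carry proofs of equivariance. *)
Definition equiv_iso A C (X Y : functor A C) : Prop :=
  exists T : nattrans A C, [/\ ntsrc T = X, nttgt T = Y,
    forall g x, T (gact g x) = fM (gact g) (T x) & forall x, is_iso (T x)].

Lemma equiv_iso_trans A C (X Y Z : functor A C) :
  equiv_iso X Y -> equiv_iso Y Z -> equiv_iso X Z.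
Proof.
move=> [T [T1 T2 TG Ti]] [S [S1 S2 SG Si]].
have e : ntsrc S = nttgt T by rewrite S1 T2.
have e' x : src (S x) = tgt (T x) by exact: nt_comp_ok.
exists (compnt e); split=> //= [g x|x]; rewrite !compE.
- by rewrite fM_comp // SG TG.
- exact: iso_comp.
Qed.

Lemma whisker_natural A C D (F : functor C D) (T : nattrans A C) :
  is_natural (compF F (ntsrc T)) (compF F (nttgt T)) (fun x => fM F (T x)).
Proof.
split=> [x|x|f e e']; rewrite /= ?src_fM ?tgt_fM ?src_ntc ?tgt_ntc //.
by rewrite !compE -!fM_comp ?ntc_comp //; ends.
Qed.

Lemma equiv_iso_map A C D (F : functor C D) (X Y : functor A C) :
  equivariant_functor F -> equiv_iso X Y -> equiv_iso (compF F X) (compF F Y).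
Proof.
move=> hF [T [T1 T2 TG Ti]]; exists (NatTrans (whisker_natural F T)).
split=> //=; rewrite ?T1 ?T2 //.
- move=> g x; rewrite TG.
  by rewrite -[LHS]/(fM (compF F (gact g)) (T x)) hF.
- by move=> x; exact: iso_fM.
Qed.

Lemma equivariantO A C (X : functor A C) : equivariant_functor X ->
  forall g a, X (gact g a) = gact g (X a).
Proof. by move=> hX g a; rewrite -[LHS]/(compF X (gact g) a) hX. Qed.

Lemma equivariantM A C (X : functor A C) : equivariant_functor X ->
  forall g p, fM X (fM (gact g) p) = fM (gact g) (fM X p).
Proof. by move=> hX g p; rewrite -[LHS]/(fM (compF X (gact g)) p) hX. Qed.

Lemma catG_iso A C (T : Mor (catG A C)) :
  (forall x, is_iso ((sval T : nattrans A C) x)) -> is_iso T.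
Proof.
move=> Ti; have i := funcat_iso Ti; apply: subcat_iso => //.
have [e1 e2 _ _] := invmP i.
have [h1 h2 h3] := svalP T; split.
- by move: h2; rewrite -[nttgt _]/(tgt (sval T)) -e1.
- by move: h1; rewrite -[ntsrc _]/(src (sval T)) -e2.
- by move=> g x; rewrite !invm_component // h3 invm_fM.
Qed.

Lemma gactM C (g h : gT) (x : Ob C) : gact (g * h)%g x = gact g (gact h x).
Proof. by case: (gactP C) => _ ->. Qed.

Lemma gactMM C (g h : gT) (f : Mor C) :
  fM (gact (g * h)%g) f = fM (gact g) (fM (gact h) f).
Proof. by case: (gactP C) => _ ->. Qed.

(** Any two objects of [EG] are joined by a morphism, and constant functors send it to an identity.
    Naturality therefore makes a transformation between them constant, and equivariance makes its
    value fixed. *)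
Lemma fixed_to_hfixed_ff C : fully_faithful (fixed_to_hfixed C).
Proof.
apply: ffI.
- move=> f f' _ _ e; apply: sig_eq.
  by have := congr1 (fun T : Mor (catG (EG gT) C) =>
    (sval T : nattrans (EG gT) C) 1%g) e.
- move=> x y [T TG] /eq_sval /= sT /eq_sval /= tT.
  have [_ _ hT] := TG.
  have T1 h : T h = T 1%g.
    have := ntc_comp T ((h, 1%g) : Mor (EG gT)); rewrite sT tT /=.
    by rewrite comp1r ?comp1l // ?tgt_ntc ?src_ntc ?tT ?sT.
  have fixT g : fM (gact g) (T 1%g) = T 1%g by rewrite -hT T1.
  have e1 : src (T 1%g) = sval x by rewrite src_ntc sT.
  have e2 : tgt (T 1%g) = sval y by rewrite tgt_ntc tT.
  exists (exist _ (T 1%g) fixT : Mor (fixedC C)).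
  split; apply: sig_eq => //=; apply: nattrans_eq => //=.
  + by rewrite e1 sT.
  + by rewrite e2 tT.
Qed.

Lemma fixed_to_hfixed_equivalence C :
  is_equivalence (fixed_to_hfixed C) <->
  forall X : functor (EG gT) C, equivariant_functor X ->
    exists x : Ob (fixedC C), equiv_iso (constF (EG gT) (sval x)) X.
Proof.
split=> [eq X hX|H].
- have [x [h [ih /eq_sval /= e1 /eq_sval /= e2]]] :=
    equivalence_es eq (exist _ X hX : Ob (catG (EG gT) C)).
  exists x, (sval h); split=> //; first by have [] := svalP h.
  by move=> g; apply: iso_component; exact: (iso_fM (incl _) ih).
- apply: ff_es_equivalence; first exact: fixed_to_hfixed_ff.
  move=> [X hX]; have [x [T [T1 T2 TG Ti]]] := H X hX.
  have hT : sM (equivariant_sub (EG gT) C) T.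
    by split=> //; rewrite ?T2 // T1; exact: const_equivariant.
  exists x, (exist _ T hT : Mor (catG (EG gT) C)).
  by split; [exact: catG_iso | exact: sig_eq | exact: sig_eq].
Qed.

Lemma const_iso_fixed C (x y : Ob (fixedC C)) :
  equiv_iso (constF (EG gT) (sval x)) (constF (EG gT) (sval y)) ->
  exists f : Mor (fixedC C), [/\ is_iso f, src f = x & tgt f = y].
Proof.
move=> [T [T1 T2 TG Ti]].
have hT : sM (equivariant_sub (EG gT) C) T.
  by split=> //; rewrite ?T1 ?T2; exact: const_equivariant.
pose T' : Mor (catG (EG gT) C) := exist _ T hT.
have [||f [f1 f2 f3]] := @ff_full _ _ _ (@fixed_to_hfixed_ff C) x y T'.
- exact: sig_eq.
- exact: sig_eq.
exists f; split=> //; apply: (ff_iso (@fixed_to_hfixed_ff C)).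
by rewrite f3; exact: catG_iso.
Qed.

(** The lift of a fixed morphism between fixed objects is fixed, since its translates have the same
    ends and the same image under [F]. *)
Lemma fixed_map_ff C D (F : functor C D) (hF : equivariant_functor F) :
  fully_faithful F -> fully_faithful (fixed_map hF).
Proof.
move=> ff; apply: ffI.
- move=> f f' /eq_sval es /eq_sval et /eq_sval e.
  by apply: sig_eq; exact: (ff_inj ff).
- move=> x y h /eq_sval /= es /eq_sval /= et.
  have [f [f1 f2 f3]] := ff_full ff es et.
  have fixf : sM (fixed_sub C) f.
    move=> g; apply: (ff_inj ff).
    + by rewrite src_fM f1 (svalP x).
    + by rewrite tgt_fM f2 (svalP y).
    + by rewrite equivariantM // f3 (svalP h).
  exists (exist _ f fixf : Mor (fixedC C)).
  by split; apply: sig_eq.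
Qed.

(** A quasi-inverse of [F] need not be equivariant. But [gT] acts freely and transitively on the
    objects of [EG], so a choice over the unit spreads: an isomorphism f : F x -> Y 1 has translates
    from F (g x) to Y g. *)
Lemma hfixed_lift C D (F : functor C D) (hF : equivariant_functor F)
  (Y : functor (EG gT) D) : equivariant_functor Y ->
  fully_faithful F -> essentially_surjective F ->
  exists Z : functor (EG gT) C,
    equivariant_functor Z /\ equiv_iso (compF F Z) Y.
Proof.
move=> hY ff es; have [x [f [fi f1 f2]]] := es (Y 1%g).
pose ZO (g : Ob (EG gT)) := gact g x.
pose phi (g : Ob (EG gT)) := fM (gact g) f.
have phiP g : [/\ is_iso (phi g), src (phi g) = F (ZO g) & tgt (phi g) = Y g].
  split; first exact: iso_fM.
  - by rewrite src_fM f1 -(equivariantO hF).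
  - by rewrite tgt_fM f2 -(equivariantO hY) /= mulg1.
have [Z [T [ZE T1 T2 TE]]] := ff_lift ff phiP.
have TG g h : T (g * h)%g = fM (gact g) (T h) by rewrite !TE /phi gactMM.
have Ti h : is_iso (T h) by rewrite TE; case: (phiP h).
exists Z; split; last by exists T; split.
move=> g; apply: functor_eq => [h|p]; first by rewrite /= !ZE /ZO gactM.
rewrite /=; apply: (ff_inj ff).
- by rewrite !src_fM !ZE /ZO gactM.
- by rewrite !tgt_fM !ZE /ZO gactM.
(* Both sides are compared after composing with [T] at [g * p.1], using [TG] and naturality of [T]
   at [p] and at its translate. *)
pose gp : Mor (EG gT) := fM (gact g) p.
have n := ntc_comp T gp; have n' := ntc_comp T p.
rewrite T1 T2 /= in n n'.
rewrite (equivariantM hF).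
apply: (comp_injl (Ti (g * p.1)%g)).
- by rewrite src_ntc T1 !tgt_fM.
- by rewrite src_ntc T1 !tgt_fM /= -(equivariantO hF) !ZE /ZO gactM.
rewrite n TG -fM_comp; last by rewrite src_ntc T1 !tgt_fM.
rewrite n' fM_comp; last by rewrite src_fM tgt_ntc T2.
by rewrite -TG /gp -(equivariantM hY).
Qed.

End EquivariantIsomorphisms.

(** * The functor s: parsummable structure and equivalence *)

Section SaturationUnit.
Variable C : parsummable.

Lemma sat_unit_eqv : equivariant (sat_unit C).
Proof.
split.
- move=> u x; apply: sig_eq; apply: functor_eq => [w|p] //=.
  by rewrite act_idm.
- move=> v u f; apply: sig_eq; apply: nattrans_eq => /=.
  + by apply: functor_eq => [w|p] /=; rewrite ?act_idm src_act.
  + by apply: functor_eq => [w|p] /=; rewrite ?act_idm tgt_act.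
  + by move=> w; rewrite compm1l.
Qed.

Lemma idm_plusO (x y : Ob C) (h : disjoint_supp x y) (f g : Mor C)
  (h' : mdisjoint f g) : f = idm x -> g = idm y ->
  idm (plusO plus h) = plusM plus h'.
Proof. by move=> ef eg; subst f g; rewrite (plusM_idm h' h). Qed.

Lemma sat_unitF_plus (x y : Ob C) (h : disjoint_supp x y)
  (h' : disjoint_supp (sat_unit C x) (sat_unit C y)) :
  constF EM (plusO plus h) = sat_plusF h'.
Proof.
by apply: functor_eq => [w|p]; [exact: plusO_eq | exact: idm_plusO].
Qed.

Lemma sat_unit_morphism : parsum_morphism (sat_unit C).
Proof.
apply: (@ParsumMorphism _ _ _ sat_unit_eqv).
- exact: sig_eq.
- by move=> x y h; apply: sig_eq; exact: sat_unitF_plus.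
- move=> f g h; apply: sat_nt_eq => [||w]; last exact: plusM_eq.
  + rewrite src_sat_plus src_fM (src_plusM h (proj1 h)); apply: sig_eq.
    move: (proj1 (mdisjoint_map _ h)); rewrite !src_fM => k.
    exact: sat_unitF_plus.
  + rewrite tgt_sat_plus tgt_fM (tgt_plusM h (proj2 h)); apply: sig_eq.
    move: (proj2 (mdisjoint_map _ h)); rewrite !tgt_fM => k.
    exact: sat_unitF_plus.
Qed.

(** Naturality along the morphism from [inj1] to [w] makes a transformation between constant
    functors constant. *)
Lemma sat_unit_ff : fully_faithful (sat_unit C).
Proof.
apply: ffI.
- move=> f f' _ _ e.
  by have := congr1 (fun T : Mor (sat C) =>
    (sval T : nattrans EM C) inj1) e.
- move=> x y h hs ht.
  have sh : ntsrc (sval h) = constF EM x := eq_sval hs.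
  have th : nttgt (sval h) = constF EM y := eq_sval ht.
  have s0 w : src ((sval h : nattrans EM C) w) = x by rewrite src_ntc sh.
  have t0 w : tgt ((sval h : nattrans EM C) w) = y by rewrite tgt_ntc th.
  exists ((sval h : nattrans EM C) inj1).
  have e1 : src (fM (sat_unit C) ((sval h : nattrans EM C) inj1)) = src h.
    by rewrite src_fM s0 hs.
  have e2 : tgt (fM (sat_unit C) ((sval h : nattrans EM C) inj1)) = tgt h.
    by rewrite tgt_fM t0 ht.
  split=> //; apply: sat_nt_eq => // w.
  have := ntc_comp (sval h) ((w, inj1) : Mor EM); rewrite sh th /=.
  by rewrite comp1r ?comp1l.
Qed.

(** The images under [X] of the unique morphisms from [inj1] to [w] identify the constant functor at
    [X inj1] with [X]. *)
Lemma sat_unit_es : essentially_surjective (sat_unit C).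
Proof.
move=> [X hX]; exists (X inj1).
have nat : is_natural (constF EM (X inj1)) X (fun w => fM X (w, inj1)).
  split=> [w|w|[v u] e e']; rewrite ?src_fM ?tgt_fM //= !compE.
  by rewrite comp1r -?fM_comp ?src_fM //; congr (fM X _); rewrite -compE.
have fin : sM (full (@fin_supported (catM C))) (NatTrans nat).
  by split=> //; exact: const_fin_supp.
exists (exist _ (NatTrans nat) fin : Mor (sat C)).
split; [| exact: sig_eq | exact: sig_eq].
apply: full_iso; apply: funcat_iso => w /=; apply: iso_fM.
by apply: (@isoP EM _ (inj1, w)) => //; rewrite -compE.
Qed.

End SaturationUnit.

(** * Fixed objects of the saturation from homotopy fixed points *)

Section Saturation.
Variable K : bijections.
Variable gT : finGroupType.
Local Notation U := (omegaG gT).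
Local Notation hU := (omegaG_countable gT).

(** The translate by [g] of the indicator function of the unit is the indicator function of [g], so
    this orbit in omega^G is free. *)
Definition orbit_point (g : gT) : nat :=
  kapV K hU (gsact g ([ffun h => nat_of_bool (h == 1%g)] : U)).

Lemma orbit_point_inj : injective orbit_point.
Proof.
move=> g h /(can_inj (kapVK K hU)) /ffunP /(_ g).
rewrite !ffunE mulVg eqxx; case: eqP => // /eqP.
by rewrite -eq_mulVg1 => /eqP.
Qed.

Definition translation (g : gT) : inj := transfer K hU hU (@gsact_inj gT U g).

Lemma translation_orbit_point g h :
  translation g (orbit_point h) = orbit_point (g * h)%g.
Proof. by rewrite /= /orbit_point kapVK gsactM. Qed.

(* Equivariant for the action of [gT] on injections by precomposition, and
   dependent only on the values of [w] at finitely many points. *)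
Definition argmin_orbit (w : inj) : gT :=
  [arg min_(g < 1%g) w (orbit_point g)].

(** The minimizer is unique because [w] and [orbit_point] are injective. *)
Lemma argmin_orbitP (w : inj) g :
  (forall h, w (orbit_point g) <= w (orbit_point h)) -> argmin_orbit w = g.
Proof.
move=> hg; rewrite /argmin_orbit; case: arg_minnP => // r _ hr.
apply/orbit_point_inj/(@inj_injective w)/eqP.
by rewrite eqn_leq hg hr.
Qed.

Lemma argmin_orbit_le (w : inj) h :
  w (orbit_point (argmin_orbit w)) <= w (orbit_point h).
Proof. by rewrite /argmin_orbit; case: arg_minnP => // r _; exact. Qed.

(** [translation g] permutes the orbit points by left multiplication, so a minimizer h for
    [injM w (translation g)] gives the minimizer g h for [w]. *)
Lemma argmin_orbit_translation (w : inj) g :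
  argmin_orbit w = (g * argmin_orbit (injM w (translation g)))%g.
Proof.
have E x : injM w (translation g) (orbit_point x) = w (orbit_point (g * x)%g).
  by rewrite -translation_orbit_point.
apply: argmin_orbitP => h; rewrite -E -[h](mulKVg g) -E.
exact: argmin_orbit_le.
Qed.

Lemma argmin_orbit_supp (w u : inj) :
  (forall g, u (orbit_point g) = orbit_point g) ->
  argmin_orbit (injM w u) = argmin_orbit w.
Proof.
move=> hu; apply: argmin_orbitP => h.
by rewrite /= !hu; exact: argmin_orbit_le.
Qed.

Lemma sat_fixed_of_hfixed (C : parsummable)
  (Z : functor (EG gT) (eval K hU C)) : equivariant_functor Z ->
  exists y : Ob (FG K gT (sat C)), equiv_iso
    (constF (EG gT) (sval y))
    (compF (sat_unit C : functor (eval K hU C) (eval K hU (sat C))) Z).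
Proof.
move=> hZ.
have ZO g h : act (translation g, Z h) = Z (g * h)%g.
  by have := equivariantO hZ g h; rewrite /= => ->.
have ZM g p : fM act ((translation g, translation g), fM Z p) =
    fM Z ((g * p.1, g * p.2)%g).
  by have := equivariantM hZ g p; rewrite /= => ->.
pose r := argmin_orbit.
have rfun : @is_functor EM (indisc gT) r (fun p => (r p.1, r p.2)) by split.
pose Y : functor EM C := compF Z (Functor rfun).
have [A hA] := choice (fun g : gT => pc_tame (Z g)).
(* If [u] fixes the orbit points, then [r (injM w u) = r w]; if it fixes the supports of all [Z g],
   then it fixes these objects and, by [uM_supp], the morphisms between them. *)
pose B := range orbit_point `|` \bigcup_g A g.
have fB : finite_set B.
  rewrite finite_setU; split; first exact/finite_image/finite_finset.
  by apply: bigcup_finite => [|g _]; [exact: finite_finset | case: (hA g)].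
have sB g : supported B (Z g).
  by apply: supported_sub (proj2 (hA g)) => n An; right; exists g.
have sY : supported B (Y : Ob (catM C)).
  move=> u uB.
  have ru w : r (injM w u) = r w.
    by apply: argmin_orbit_supp => g; apply: uB; left; exists g.
  apply: functor_eq => [w|[v w]] /=; rewrite !ru; first exact: sB uB.
  by apply: (uM_supp fB) uB; rewrite ?src_fM ?tgt_fM; exact: sB.
have finY : fin_supported (Y : Ob (catM C)) by exists B.
(* Acting by [g] replaces Z (r w) by Z (g r (w g)), which is Z (r w) by equivariance of [r]. *)
have fixY g : act (translation g, exist _ Y finY : Ob (sat C)) =
    exist _ Y finY.
  apply: sig_eq; apply: functor_eq => [w|[v w]] /=.
    by rewrite ZO -argmin_orbit_translation.
  by rewrite ZM /= -!argmin_orbit_translation.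
exists (exist _ (exist _ Y finY) fixY).
(* The unique morphism of [EG] from [r w] to [g] compares [Y] at [w] with [Z g]; uniqueness yields
   naturality in both [w] and [g]. *)
have nat g : is_natural Y (constF EM (Z g : Ob C))
    (fun w => fM Z (g, r w) : Mor C).
  split=> [w|w|[v w] e e']; rewrite ?src_fM ?tgt_fM //= !compE.
  rewrite comp1l ?tgt_fM // -fM_comp //; congr (fM Z _); by rewrite -compE.
have fin g : sM (full (@fin_supported (catM C))) (NatTrans (nat g)).
  by split=> //; exact: const_fin_supp.
pose T (g : gT) : Mor (sat C) := exist _ (NatTrans (nat g)) (fin g).
have natT : @is_natural (EG gT) (eval K hU (sat C))
    (constF (EG gT) (exist _ Y finY : Ob (sat C)))
    (compF (sat_unit C : functor (eval K hU C) (eval K hU (sat C))) Z) T.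
  split=> [g|g|[h g] e e']; [exact: sig_eq | exact: sig_eq |].
  apply: sat_nt_eq => [||w].
  - by rewrite !src_compm src_fM; exact: sig_eq.
  - by rewrite !tgt_compm tgt_fM; exact: sig_eq.
  - rewrite /= !compE comp1r ?src_fM // -fM_comp //.
    by congr (fM Z _); rewrite -compE.
exists (NatTrans natT); split=> // [g h|g].
- apply: sat_nt_eq => [||w] /=.
  + by apply: sig_eq; exact: (esym (eq_sval (fixY g))).
  + apply: sig_eq => /=; apply: functor_eq => [w|p] /=; rewrite ?act_idm ZO //.
  + rewrite compE comp1l ?tgt_fM // ZM /=.
    by rewrite -argmin_orbit_translation.
- apply: full_iso; apply: funcat_iso => w /=; apply: iso_fM.
  by apply: (@isoP (EG gT) _ (r w, g)) => //; rewrite -compE.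
Qed.

End Saturation.

(** * Saturation of [sat C] and global equivalence of s *)

Lemma eval_equivariant (K : bijections) (gT : finGroupType) (C D : Mcat)
  (F : functor C D) : equivariant F ->
  equivariant_functor (F : functor (eval K (omegaG_countable gT) C)
                                   (eval K (omegaG_countable gT) D)).
Proof. by move=> hF g; exact: eval_map_eqv. Qed.

Lemma sat_saturated (K : bijections) (C : parsummable) : saturated K (sat C).
Proof.
move=> gT; apply/fixed_to_hfixed_equivalence => X hX.
have [Z [hZ ZX]] := hfixed_lift
  (@eval_equivariant K gT _ _ _ (sat_unit_eqv C)) hX
  (@sat_unit_ff C) (@sat_unit_es C).
have [y yZ] := sat_fixed_of_hfixed hZ.
by exists y; exact: equiv_iso_trans yZ ZX.
Qed.

(** For essential surjectivity on fixed points, a fixed object [y] of [sat C], seen as a constant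
    homotopy fixed point, is lifted along s to [Z]; saturation of [C] replaces [Z] by a fixed object
    [x], and the resulting isomorphism from s x to [y] comes from a fixed one. *)
Lemma sat_unit_global (K : bijections) (C : parsummable)
  (hs : equivariant (sat_unit C)) : saturated K C -> global_equivalence K hs.
Proof.
move=> sC gT; apply: equivalence_weak; apply: ff_es_equivalence.
  by apply: fixed_map_ff; exact: sat_unit_ff.
move=> y; have hs' := @eval_equivariant K gT _ _ _ hs.
have [Z [hZ Zy]] := hfixed_lift hs' (const_equivariant y)
  (@sat_unit_ff C) (@sat_unit_es C).
have [x xZ] := (fixed_to_hfixed_equivalence _).1 (sC gT) Z hZ.
have sxZ := equiv_iso_map hs' xZ.
have e : compF (sat_unit C : functor (eval K _ C) (eval K _ (sat C)))
    (constF (EG gT) (sval x)) =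
    constF (EG gT) (sval (FG_map K gT hs x)).
  by apply: functor_eq => [g|p] //; exact: fM_idm.
rewrite e in sxZ.
have [f [fi f1 f2]] := const_iso_fixed (equiv_iso_trans sxZ Zy).
by exists x, f.
Qed.

Theorem theorem7p27 (K : bijections) (C : parsummable) :
  saturated K (sat C) /\
  (parsum_morphism (sat_unit C) /\ is_equivalence (sat_unit C)) /\
  (saturated K C ->
     exists hs : parsum_morphism (sat_unit C),
       global_equivalence K (pm_eqv hs)).
Proof.
split; first exact: sat_saturated.
split.
  split; first exact: sat_unit_morphism.
  exact: ff_es_equivalence (@sat_unit_ff C) (@sat_unit_es C).
by move=> sC; exists (sat_unit_morphism C); exact: sat_unit_global.
Qed.
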